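(* Let $n>1$ be an integer and let $X=X_{CS}^n:\mathbb{S}^{n-1}\times\mathbb{S}^{n-1}\times\mathbb{S}^1\to\mathbb{S}^{2n}\subset\mathbb{R}^{2n+1}$ be the Carlotto–Schulz minimal embedding (as defined in the context), with stability operator $J=-\Delta-|A|^2-(2n-1)$. Then the multiplicity of $-(2n-1)$ as an eigenvalue of $J$ is at least $n^2+2n+1$; that is, the real vector space of smooth functions $u$ on $\mathbb{S}^{n-1}\times\mathbb{S}^{n-1}\times\mathbb{S}^1$ with $J(u)=-(2n-1)u$ has dimension at least $n^2+2n+1$.
   Context: Construction of $X_{CS}^n$. For an integer $n>1$, consider the ODE system $$r'(t)=\cos\alpha(t),\qquad \theta'(t)=\frac{\sin\alpha(t)}{\sin r(t)},$$ $$\alpha'(t)=(2n-2)\csc r(t)\cos\alpha(t)\cot(2\theta(t))-(2n-1)\cot r(t)\sin\alpha(t).$$ By a known theorem of Carlotto and Schulz, there exist $r_0\in(0,\pi)$ and $s^*=T/4>0$ such that the solution $(r,\theta,\alpha)$ with initial conditions $\theta(0)=\pi/4$, $r(0)=r_0$, $\alpha(0)=-\pi/2$ satisfies $\theta(s^* )>0$, $r(s^* )=\pi/2$, $\alpha(s^* )=0$, and on $[0,s^*]$ the function $\theta$ is strictly decreasing while $r$ and $\alpha$ are strictly increasing. Fix such $r_0$ and $T$ and the corresponding solution. By the symmetries of the system, the solution extends to all $t\in\mathbb{R}$ with $r(t)\in(0,\pi)$ and $\theta(t)\in(0,\pi/2)$, the functions $r$ and $\theta$ are $T$-periodic, and $\alpha(t+T)=\alpha(t)+2\pi$.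 Identify $\mathbb{S}^1=\mathbb{R}/T\mathbb{Z}$. The Carlotto–Schulz embedding is $$X_{CS}^n(y,z,t)=\bigl(\sin r(t)\cos\theta(t)\,y,\ \sin r(t)\sin\theta(t)\,z,\ \cos r(t)\bigr),\qquad y,z\in\mathbb{S}^{n-1}\subset\mathbb{R}^n,\ t\in\mathbb{S}^1.$$ It is known to be a minimal embedding into the unit sphere $\mathbb{S}^{2n}$, of a manifold of dimension $2n-1$. The domain carries the metric induced by $X_{CS}^n$. Stability operator. $\Delta$ is the Laplace–Beltrami operator of the induced metric (with the sign for which $-\Delta$ is nonnegative), and $|A|^2=\kappa_1^2+\dots+\kappa_{2n-1}^2$ is the sum of the squares of the principal curvatures of the hypersurface in $\mathbb{S}^{2n}$. The stability operator is $J(u)=-\Delta u-|A|^2u-(2n-1)u$, acting on smooth functions. A real number $\lambda$ is an eigenvalue of $J$ if $J(u)=\lambda u$ for some nonzero smooth $u$; its multiplicity is the dimension of the space of all such $u$ (together with $0$). *)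

(* Defs.v *)
From HB Require Import structures.
From mathcomp Require Import all_boot all_order all_algebra.
From mathcomp Require Import all_classical all_reals all_analysis.
From mathcomp Require Import ring lra.

Set Implicit Arguments.
Unset Strict Implicit.
Unset Printing Implicit Defensive.

Import Order.TTheory GRing.Theory Num.Theory.
Import numFieldNormedType.Exports.
Local Open Scope classical_set_scope.
Local Open Scope ring_scope.

Definition dotv (R : realType) (k : nat) (u v : 'rV[R]_k) : R :=
  (u *m v^T) 0 0.

(* Below, [F : 'rV_d -> 'rV_k] is a local parametrization of a hypersurface of
   the unit sphere of R^k (so k = d + 2), and [w] is a function on the
   hypersurface read in the coordinates given by [F]. *)

Definition pd (R : realType) (d : nat) (W : normedModType R) (i : 'I_d)
  (f : 'rV[R]_d -> W) : 'rV[R]_d -> W := 'D_(delta_mx 0 i) f.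

(* All iterated directional derivatives exist and are Frechet differentiable
   (hence continuous), that is, [f] is of class C^oo on the whole space. *)
Definition smooth (R : realType) (d : nat) (f : 'rV[R]_d -> R) : Prop :=
  forall (vs : seq 'rV[R]_d) (x : 'rV[R]_d),
    differentiable (foldr (fun v g => 'D_v g) f vs) x.

Definition metric (R : realType) (d k : nat) (F : 'rV[R]_d -> 'rV[R]_k)
  (x : 'rV[R]_d) : 'M[R]_d :=
  \matrix_(i, j) dotv (pd i F x) (pd j F x).

Definition laplace_beltrami (R : realType) (d k : nat)
  (F : 'rV[R]_d -> 'rV[R]_k) (w : 'rV[R]_d -> R) (x : 'rV[R]_d) : R :=
  (Num.sqrt (\det (metric F x)))^-1 *
  \sum_(i < d) pd i (fun z => \sum_(j < d)
     Num.sqrt (\det (metric F z)) * invmx (metric F z) i j * pd j w z) x.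

Definition unit_normal (R : realType) (d k : nat) (F : 'rV[R]_d -> 'rV[R]_k)
  (x : 'rV[R]_d) (N : 'rV[R]_k) : Prop :=
  [/\ dotv N N = 1, dotv N (F x) = 0 & forall i, dotv N (pd i F x) = 0].

Definition second_fundamental_form (R : realType) (d k : nat)
  (F : 'rV[R]_d -> 'rV[R]_k) (N : 'rV[R]_k) (x : 'rV[R]_d) : 'M[R]_d :=
  \matrix_(i, j) dotv (pd i (pd j F) x) N.

Definition shape_operator (R : realType) (d k : nat)
  (F : 'rV[R]_d -> 'rV[R]_k) (N : 'rV[R]_k) (x : 'rV[R]_d) : 'M[R]_d :=
  invmx (metric F x) *m second_fundamental_form F N x.

(* The eigenvalues of the shape operator listed with multiplicity; the list is
   determined up to order and, because of the two unit normals, a global sign. *)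
Definition principal_curvatures (R : realType) (d k : nat)
  (F : 'rV[R]_d -> 'rV[R]_k) (x : 'rV[R]_d) (kappa : 'I_d -> R) : Prop :=
  exists2 N, unit_normal F x N &
    char_poly (shape_operator F N x) = \prod_(i < d) ('X - (kappa i)%:P).

(* |A|^2; the set below is a singleton since the sum of the squares depends
   neither on the order of the principal curvatures nor on the unit normal. *)
Definition sqnormA (R : realType) (d k : nat) (F : 'rV[R]_d -> 'rV[R]_k)
  (x : 'rV[R]_d) : R :=
  get [set a : R | exists2 kappa, principal_curvatures F x kappa
                                & a = \sum_(i < d) kappa i ^+ 2].

Definition stability_operator (R : realType) (d k : nat)
  (F : 'rV[R]_d -> 'rV[R]_k) (w : 'rV[R]_d -> R) (x : 'rV[R]_d) : R :=
  - laplace_beltrami F w x - sqnormA F x * w x - d%:R * w x.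

Definition sphere (R : realType) (n : nat) : Type :=
  {y : 'rV[R]_n | dotv y y == 1}.

(* Functions on S^(n-1) x S^(n-1) x R/TZ are the functions on [mfd n] that are
   T-periodic in the last variable. *)
Definition mfd (R : realType) (n : nat) : Type :=
  (sphere R n * sphere R n * R)%type.

Definition periodic_last (R : realType) (n : nat) (T : R) (u : mfd R n -> R) :
  Prop := forall y z t, u (y, z, t + T) = u (y, z, t).

Definition orthoframe (R : realType) (n : nat) : Type :=
  {E : 'M[R]_(n.-1 + 1, n) | E *m E^T == 1%:M}.

(* Inverse stereographic projection from the pole v, the last row of the
   orthonormal frame; with e_i the other rows it maps p to
   (2 sum_i p_i e_i + (|p|^2 - 1) v) / (|p|^2 + 1). *)
Definition stereo_vec (R : realType) (n : nat) (E : orthoframe R n)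
  (p : 'rV[R]_(n.-1)) : 'rV[R]_n :=
  (dotv p p + 1)^-1 *:
    (row_mx (2 *: p) ((dotv p p - 1)%:M : 'M[R]_1) *m sval E).

Lemma stereo_vec_sphere (R : realType) (n : nat) (E : orthoframe R n)
  (p : 'rV[R]_(n.-1)) : dotv (stereo_vec E p) (stereo_vec E p) == 1.
Proof.
rewrite /stereo_vec; have /eqP := svalP E.
move: (sval E) => {}E hE.
have p0 : 0 <= dotv p p.
  by rewrite /dotv mxE; apply: sumr_ge0 => i _; rewrite mxE -expr2 sqr_ge0.
have trZ k (a : R) (u : 'rV[R]_k) : (a *: u)^T = a *: u^T.
  by apply/matrixP => i j; rewrite !mxE.
rewrite {1}/dotv trZ -scalemxAl -scalemxAr.
rewrite trmx_mul mulmxA -(mulmxA _ E) hE mulmx1 tr_row_mx mul_row_col.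
rewrite tr_scalar_mx trZ -scalemxAl -scalemxAr.
rewrite -scalar_mxM [p *m _]mx11_scalar -/(dotv p p) !mxE eqxx !mulr1n.
by move: (dotv p p) p0 => s s0; apply/eqP; field; apply: lt0r_neq0; lra.
Qed.

Definition stereo (R : realType) (n : nat) (E : orthoframe R n)
  (p : 'rV[R]_(n.-1)) : sphere R n :=
  exist _ (stereo_vec E p) (stereo_vec_sphere E p).

(* The atlas: the product of two stereographic charts with t |-> t mod T;
   all orthonormal frames are allowed, so these charts cover the manifold.
   The dimension (n-1) + (n-1) + 1 is 2n-1 for n >= 1. *)
Definition chart (R : realType) (n : nat) (E E' : orthoframe R n)
  (x : 'rV[R]_(n.-1 + n.-1 + 1)) : mfd R n :=
  (stereo E (lsubmx (lsubmx x)), stereo E' (rsubmx (lsubmx x)),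
   rsubmx x 0 0).

Definition cot (R : realType) (x : R) : R := cos x / sin x.

Record CS_profile (R : realType) (n : nat) (T r0 : R)
    (r theta alpha : R -> R) : Prop := {
  CS_T_gt0 : 0 < T;
  CS_r0 : 0 < r0 < pi;
  CS_r_range : forall t, 0 < r t < pi;
  CS_theta_range : forall t, 0 < theta t < pi / 2;
  CS_r_ode : forall t : R, is_derive t 1 r (cos (alpha t));
  CS_theta_ode : forall t : R, is_derive t 1 theta (sin (alpha t) / sin (r t));
  CS_alpha_ode : forall t : R, is_derive t 1 alpha
    ((2 * n%:R - 2) * (sin (r t))^-1 * cos (alpha t) * cot (2 * theta t)
     - (2 * n%:R - 1) * cot (r t) * sin (alpha t));
  CS_theta_init : theta 0 = pi / 4;
  CS_r_init : r 0 = r0;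
  CS_alpha_init : alpha 0 = - (pi / 2);
  CS_theta_quarter : 0 < theta (T / 4);
  CS_r_quarter : r (T / 4) = pi / 2;
  CS_alpha_quarter : alpha (T / 4) = 0;
  CS_theta_decr :
    forall s t : R, 0 <= s -> s < t -> t <= T / 4 -> theta t < theta s;
  CS_r_incr : forall s t : R, 0 <= s -> s < t -> t <= T / 4 -> r s < r t;
  CS_alpha_incr :
    forall s t : R, 0 <= s -> s < t -> t <= T / 4 -> alpha s < alpha t;
  CS_r_periodic : forall t, r (t + T) = r t;
  CS_theta_periodic : forall t, theta (t + T) = theta t;
  CS_alpha_periodic : forall t, alpha (t + T) = alpha t + 2 * pi
}.

Definition X_CS (R : realType) (n : nat) (r theta : R -> R) (p : mfd R n) :
  'rV[R]_(n + n + 1) :=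
  let: (y, z, t) := p in
  row_mx (row_mx ((sin (r t) * cos (theta t)) *: sval y)
                 ((sin (r t) * sin (theta t)) *: sval z))
         ((cos (r t))%:M : 'M[R]_1).

Definition smooth_mfd (R : realType) (n : nat) (T : R) (u : mfd R n -> R) :
  Prop :=
  periodic_last T u /\
  forall E E' : orthoframe R n, smooth (u \o chart E E').

(* [v = J u], read in every chart of the atlas. *)
Definition is_stability (R : realType) (n k : nat) (X : mfd R n -> 'rV[R]_k)
  (u v : mfd R n -> R) : Prop :=
  forall (E E' : orthoframe R n) (x : 'rV[R]_(n.-1 + n.-1 + 1)),
    v (chart E E' x) = stability_operator (X \o chart E E') (u \o chart E E') x.

Definition stability_eigenspace (R : realType) (n k : nat) (T : R)
  (X : mfd R n -> 'rV[R]_k) (lambda : R) : set (mfd R n -> R) :=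
  [set u | smooth_mfd T u /\ is_stability X u (lambda *: u)].

Definition dim_at_least (R : realType) (V : lmodType R) (m : nat) (S : set V) :
  Prop :=
  exists f : 'I_m -> V, (forall i, S (f i)) /\
    forall c : 'I_m -> R, \sum_(i < m) c i *: f i = 0 -> forall i, c i = 0.

(* Main.v *)
(* Write the hypersurface as (a(t) y, b(t) z, c(t)), where (a, b, c) is a curve in
   S^2 parametrized by arc length, with velocity (a', b', c'), normal
   nu = (nu_1, nu_2, nu_3) and geodesic curvature kappa, and let m = n - 1.
   Minimality reads kappa = m (nu_1 / a + nu_2 / b) and
   |A|^2 = m (nu_1^2 / a^2 + nu_2^2 / b^2) + kappa^2. A function u satisfies
   J u = - (2n-1) u iff Delta u + |A|^2 u = 0. This holds for the 2n+1 components
   nu_1 y_i, nu_2 z_j, nu_3 of the Gauss map and also for the n^2 functions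
   (a b)^(-m) y_i z_j: with p = a'/a, q = b'/b the radial equation
   g'' + m (p + q) g' + (|A|^2 - m/a^2 - m/b^2) g = 0 reduces for g = (a b)^(-m)
   to a^2 + a'^2 + nu_1^2 = 1 = b^2 + b'^2 + nu_2^2. *)

Require Import Defs.
From mathcomp Require Import all_boot all_order all_algebra.
From mathcomp Require Import all_classical all_reals all_analysis.
From mathcomp Require Import ring lra zify.
Import Order.TTheory GRing.Theory Num.Theory.
Import numFieldNormedType.Exports.
Local Open Scope ring_scope.

Set Implicit Arguments.
Unset Strict Implicit.
Unset Printing Implicit Defensive.

(** Adjoining the constant 1 to the coordinates of each sphere merges the four kinds of
    eigenfunctions into one family: a factor from {1, y_i}, a factor from {1, z_j}, and a profile in
    t that depends only on which factors are constant. This family has (n + 1)^2 members. They share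
    one eigenvalue, so independence is read off at t = 0, where none of the four profiles vanishes.
    The curve is known only through its ODE. Its position, velocity and normal are the rows of an
    orthogonal 3 x 3 matrix: the row relations give the metric and the unit normal, the column
    relations give the radial equations. Derivatives of the entries are rational in the entries,
    which yields smoothness without any closed form. Since [sqnormA] is a choice from a set,
    computing it also requires uniqueness: unit normals agree up to sign, and the characteristic
    polynomial determines its roots. *)

Section DotProduct.
Variables (R : realType) (k : nat).
Implicit Types u v w : 'rV[R]_k.

Lemma dotvE u v : dotv u v = \sum_i u 0 i * v 0 i.
Proof. by rewrite /dotv mxE; apply: eq_bigr => i _; rewrite mxE. Qed.

Lemma dotvC u v : dotv u v = dotv v u.
Proof. by rewrite !dotvE; apply: eq_bigr => i _; rewrite mulrC. Qed.

Lemma dotvDl u v w : dotv (u + v) w = dotv u w + dotv v w.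
Proof. by rewrite /dotv mulmxDl mxE. Qed.

Lemma dotvZl (a : R) u v : dotv (a *: u) v = a * dotv u v.
Proof. by rewrite /dotv -scalemxAl mxE. Qed.

Lemma dotvDr u v w : dotv u (v + w) = dotv u v + dotv u w.
Proof. by rewrite !(dotvC u) dotvDl. Qed.

Lemma dotvZr (a : R) u v : dotv u (a *: v) = a * dotv u v.
Proof. by rewrite !(dotvC u) dotvZl. Qed.

Lemma dotv0l u : dotv 0 u = 0.
Proof. by rewrite /dotv mul0mx mxE. Qed.

Lemma dotv0r u : dotv u 0 = 0.
Proof. by rewrite dotvC dotv0l. Qed.

Lemma dotv_ge0 u : 0 <= dotv u u.
Proof. by rewrite dotvE; apply: sumr_ge0 => i _; rewrite -expr2 sqr_ge0. Qed.

Lemma dotv_deltal i u : dotv (delta_mx 0 i) u = u 0 i.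
Proof. by rewrite /dotv -rowE !mxE. Qed.

End DotProduct.

Lemma dotv_row_mx (R : realType) (k l : nat) (u u' : 'rV[R]_k) (v v' : 'rV[R]_l) :
  dotv (row_mx u v) (row_mx u' v') = dotv u u' + dotv v v'.
Proof. by rewrite /dotv tr_row_mx mul_row_col mxE. Qed.

Lemma dotv_scalar_mx (R : realType) (a b : R) :
  dotv (a%:M : 'rV_1) (b%:M : 'rV_1) = a * b.
Proof. by rewrite dotvE big_ord1 !mxE eqxx. Qed.

(** * Calculus of directional derivatives *)

Section DirectionalDerivatives.
Variables (R : realType) (V : normedModType R) (x v : V).

Lemma is_derive_fD (W : normedModType R) (f g : V -> W) (df dg : W) :
  is_derive x v f df -> is_derive x v g dg ->
  is_derive x v (fun y => f y + g y) (df + dg).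
Proof. exact: is_deriveD. Qed.

Lemma is_derive_fN (W : normedModType R) (f : V -> W) (df : W) :
  is_derive x v f df -> is_derive x v (fun y => - f y) (- df).
Proof. exact: is_deriveN. Qed.

Lemma is_derive_fM (f g : V -> R) (df dg : R) :
  is_derive x v f df -> is_derive x v g dg ->
  is_derive x v (fun y => f y * g y) (df * g x + f x * dg).
Proof.
move=> hf hg; have := is_deriveM hf hg.
by rewrite /GRing.scale /= addrC (mulrC (g x)).
Qed.

Lemma is_derive_fV (f : V -> R) (df : R) :
  is_derive x v f df -> f x != 0 -> is_derive x v (fun y => (f y)^-1) (- (df / f x ^+ 2)).
Proof.
move=> hf fx0; have df' : derivable f x v by [].
split; first exact: derivableV.
by rewrite deriveV // derive_val /GRing.scale /= mulNr mulrC.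
Qed.

(** The form [f x ^+ m / f x] avoids the predecessor of [m], so that [field] can treat a symbolic
    exponent, [m = 0] included. *)
Lemma is_derive_fX (f : V -> R) (df : R) (m : nat) :
  is_derive x v f df -> f x != 0 ->
  is_derive x v (fun y => f y ^+ m) (m%:R * df / f x * f x ^+ m).
Proof.
move=> hf fx0; have -> : (fun y => f y ^+ m) = f ^+ m.
  by apply/funext => y; rewrite exprfctE.
have := is_deriveX m hf.
suff -> : (m%:R * f x ^+ m.-1) *: df = m%:R * df / f x * f x ^+ m by [].
rewrite /GRing.scale /=; case: m => [|m] /=; first by rewrite !mul0r.
by rewrite exprS; field.
Qed.

Lemma is_derive_fsum (W : normedModType R) (I : finType) (f : I -> V -> W)
    (df : I -> W) : (forall i, is_derive x v (f i) (df i)) ->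
  is_derive x v (fun y => \sum_i f i y) (\sum_i df i).
Proof.
move=> hf; have -> : (fun y => \sum_i f i y) = \sum_i f i.
  by apply/funext => y; rewrite fct_sumE.
apply: (big_ind2 (fun f df => is_derive x v f df)) => //.
  exact: is_derive_cst.
by move=> *; apply: is_derive_fD.
Qed.

Lemma is_derive_line (u : V -> R) (du : R) :
  is_derive x v u du <-> is_derive (0 : R) 1 (fun h : R => u (h *: v + x)) du.
Proof.
have e : 'D_1 (fun h : R => u (h *: v + x)) 0 = 'D_v u x.
  rewrite /derive; set g1 := fun h => h^-1 *: _; set g2 := fun h => h^-1 *: _.
  suff -> : g1 = g2 by [].
  by rewrite funeqE /g1 /g2 => h /=; rewrite addr0 scale0r add0r [_%:A]mulr1.
split=> hu.
  have du' : derivable u x v by [].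
  by split; [exact: (derivable1P u x v).1|rewrite e derive_val].
have du' : derivable (fun h : R => u (h *: v + x)) 0 1 by [].
by split; [exact: (derivable1P u x v).2|rewrite -e derive_val].
Qed.

Lemma is_derive_comp (g : V -> R) (f : R -> R) (dg df : R) :
  is_derive x v g dg -> is_derive (g x) 1 f df ->
  is_derive x v (fun y => f (g y)) (df * dg).
Proof.
move=> /is_derive_line hg hf; apply/is_derive_line.
have hf0 : is_derive (g (0 *: v + x)) 1 f df by rewrite scale0r add0r.
exact: (is_derive1_comp hf0 hg).
Qed.

Lemma is_derive_mx (m n : nat) (M : V -> 'M[R]_(m, n)) (dM : 'M[R]_(m, n)) :
  (forall i j, is_derive x v (fun y => M y i j) (dM i j)) ->
  is_derive x v M dM.
Proof.
move=> hM; have dMx : derivable M x v by apply/derivable_mxP => i j.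
split=> //; rewrite derive_mx //; apply/matrixP => i j.
by rewrite mxE derive_val.
Qed.

Lemma is_derive_mx_entry (m n : nat) (M : V -> 'M[R]_(m, n)) (dM : 'M[R]_(m, n))
    i j : is_derive x v M dM -> is_derive x v (fun y => M y i j) (dM i j).
Proof.
move=> hM; have dMx : derivable M x v by [].
have /derivable_mxP/(_ i j) dij := dMx; split=> //.
have := @derive_val _ _ _ _ _ _ _ hM.
by rewrite derive_mx // => <-; rewrite mxE.
Qed.

Lemma is_derive_row_mx (m n1 n2 : nat) (M : V -> 'M[R]_(m, n1))
    (N : V -> 'M[R]_(m, n2)) dM dN :
  is_derive x v M dM -> is_derive x v N dN ->
  is_derive x v (fun y => row_mx (M y) (N y)) (row_mx dM dN).
Proof.
move=> hM hN; apply: is_derive_mx => i j; rewrite mxE.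
under eq_fun do rewrite mxE.
by case: splitP => j' _; apply: is_derive_mx_entry.
Qed.

Lemma is_derive_scalar_mx (n : nat) (f : V -> R) (df : R) :
  is_derive x v f df -> is_derive x v (fun y => (f y)%:M : 'M[R]_n) (df%:M).
Proof.
move=> hf; apply: is_derive_mx => i j; rewrite mxE; under eq_fun do rewrite mxE.
by case: (i == j); [exact: hf|exact: is_derive_cst].
Qed.

Lemma is_derive_scalemx (m n : nat) (f : V -> R) (df : R)
    (M : V -> 'M[R]_(m, n)) dM :
  is_derive x v f df -> is_derive x v M dM ->
  is_derive x v (fun y => f y *: M y) (df *: M x + f x *: dM).
Proof.
move=> hf hM; apply: is_derive_mx => i j; rewrite !mxE.
under eq_fun do rewrite mxE.
by apply: is_derive_fM => //; apply: is_derive_mx_entry.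
Qed.

Lemma is_derive_mulmxr (m n p : nat) (M : V -> 'M[R]_(m, n)) dM
    (E : 'M[R]_(n, p)) :
  is_derive x v M dM -> is_derive x v (fun y => M y *m E) (dM *m E).
Proof.
move=> hM; apply: is_derive_mx => i j; rewrite mxE.
under eq_fun do rewrite mxE.
apply: is_derive_fsum => k.
have := is_derive_fM (is_derive_mx_entry i k hM) (is_derive_cst (E k j) x v).
by rewrite mulr0 addr0.
Qed.

Lemma is_derive_dotv (k : nat) (f g : V -> 'rV[R]_k) df dg :
  is_derive x v f df -> is_derive x v g dg ->
  is_derive x v (fun y => dotv (f y) (g y)) (dotv df (g x) + dotv (f x) dg).
Proof.
move=> hf hg; rewrite !dotvE -big_split /=; under eq_fun do rewrite dotvE.
apply: is_derive_fsum => i; apply: is_derive_fM; exact: is_derive_mx_entry.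
Qed.

End DirectionalDerivatives.

(** * Hypersurfaces of the sphere in orthogonal coordinates *)

Lemma invmx_diag_mx (F : fieldType) (n : nat) (g : 'rV[F]_n) :
  (forall i, g 0 i != 0) -> invmx (diag_mx g) = diag_mx (\row_i (g 0 i)^-1).
Proof.
move=> g0; have h : diag_mx g *m diag_mx (\row_i (g 0 i)^-1) = 1%:M.
  rewrite mulmx_diag -diag_const_mx; congr diag_mx.
  by apply/rowP => i; rewrite !mxE divff.
have [u _] := mulmx1_unit h.
by rewrite -[LHS]mulmx1 -h mulKmx.
Qed.

Section OrthogonalCoordinates.
Variables (R : realType) (d k : nat) (F : 'rV[R]_d -> 'rV[R]_k).

(** The volume density [om] is supplied as an explicit nonnegative root of the determinant, so no
    square root has to be differentiated later. *)
Lemma laplace_beltrami_orthogonal (gam : 'rV[R]_d -> 'rV[R]_d)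
    (om : 'rV[R]_d -> R) (w : 'rV[R]_d -> R) (x : 'rV[R]_d) :
  (forall z i, gam z 0 i != 0) -> (forall z, 0 <= om z) ->
  (forall z, metric F z = diag_mx (gam z)) ->
  (forall z, om z ^+ 2 = \prod_i gam z 0 i) ->
  laplace_beltrami F w x =
  (om x)^-1 * \sum_i pd i (fun z => om z / gam z 0 i * pd i w z) x.
Proof.
move=> gam0 om0 hm hom.
have hdet z : Num.sqrt (\det (metric F z)) = om z.
  by rewrite hm det_diag -hom sqrtr_sqr ger0_norm.
apply: (congr2 *%R); first by rewrite hdet.
apply: eq_bigr => i _.
congr (pd i _ x); apply/funext => z.
rewrite (bigD1 i) //= big1 ?addr0 => [|j /negPf ji].
  by rewrite hdet hm invmx_diag_mx // !mxE eqxx mulr1n.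
by rewrite hm invmx_diag_mx // !mxE eq_sym ji mulr0n mulr0 mul0r.
Qed.

Variables (N : 'rV[R]_d -> 'rV[R]_k) (x : 'rV[R]_d) (gam kap : 'rV[R]_d).
Hypothesis dim : k = d.+2.
Hypothesis gam0 : forall i, gam 0 i != 0.
Hypothesis metricE : metric F x = diag_mx gam.
Hypothesis F_sphere : dotv (F x) (F x) = 1.
Hypothesis F_tangent : forall i, dotv (F x) (pd i F x) = 0.
Hypothesis N_normal : forall z, unit_normal F z (N z).
Hypothesis N_derivable : forall i, derivable N x (delta_mx 0 i).
Hypothesis F_derivable : forall i j, derivable (pd j F) x (delta_mx 0 i).
Hypothesis weingarten : forall i, pd i N x = - kap 0 i *: pd i F x.

Let metric_ij i j : dotv (pd i F x) (pd j F x) = gam 0 i *+ (i == j).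
Proof. by move/matrixP: metricE => /(_ i j); rewrite !mxE. Qed.

(* F x, N x and the tangents pd i F x are k nonzero pairwise orthogonal vectors,
   so the row vector N' is determined by its inner products with them. *)
Lemma unit_normal_unique N' : unit_normal F x N' ->
  exists2 s : R, s ^+ 2 = 1 & N' = s *: N x.
Proof.
case=> n1 n2 n3; have [m1 m2 m3] := N_normal x.
pose G : 'M[R]_(d + 2, k) :=
  col_mx (\matrix_i pd i F x) (\matrix_i (if i == 0 then F x else N x) : 'M[R]_(2, k)).
pose D : 'rV[R]_(d + 2) := row_mx gam (const_mx 1).
have GG : G *m G^T = diag_mx D.
  rewrite tr_col_mx mul_col_row diag_mx_row.
  have ent p q (A : 'M[R]_(p, k)) (B : 'M[R]_(q, k)) i j :
      (A *m B^T) i j = dotv (row i A) (row j B).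
    by rewrite mxE dotvE; apply: eq_bigr => l _; rewrite !mxE.
  congr block_mx; apply/matrixP => i j; rewrite ent !rowK.
  - by rewrite metric_ij !mxE.
  - by rewrite mxE; case: ifP => _; rewrite dotvC ?F_tangent ?m3.
  - by rewrite mxE; case: ifP => _; rewrite ?F_tangent ?m3.
  - rewrite !mxE; case: i j => [[|[|[]]]//= ?] [[|[|[]]]//= ?] //=.
    by rewrite dotvC.
have Gunit : \rank G^T = k.
  have dk : (d + 2)%N = k by rewrite dim addn2.
  have h : (d + 2 <= \rank G^T)%N.
    have hD : \rank (diag_mx D) = (d + 2)%N.
      apply: mxrank_unit; rewrite unitmxE det_diag unitfE; apply/prodf_neq0 => i _.
      by rewrite mxE; case: splitP => j _; rewrite ?mxE ?oner_eq0.
    by rewrite -[leqLHS]hD -GG mxrankM_maxr.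
  by apply/eqP; rewrite eqn_leq rank_leq_row (leq_trans _ h) // dk.
have free : row_free G^T by rewrite /row_free Gunit.
set s := dotv N' (N x); have e : N' = s *: N x.
  apply/eqP; rewrite -subr_eq0; apply/eqP; apply: (row_free_inj free).
  rewrite mul0mx; apply/rowP => i; rewrite mxE.
  have -> : \sum_j (N' - s *: N x) 0 j * G^T j i = dotv (N' - s *: N x) (row i G).
    by rewrite dotvE; apply: eq_bigr => l _; rewrite !mxE.
  rewrite -scaleNr dotvDl dotvZl [RHS]mxE.
  case: (splitP i) => j ij.
    have -> : i = lshift 2 j by apply: val_inj.
    by rewrite rowKu rowK n3 m3 mulr0 addr0.
  have -> : i = rshift d j by apply: val_inj.
  rewrite rowKd rowK; case: ifP => _; first by rewrite n2 m2 mulr0 addr0.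
  by rewrite m1 mulr1 subrr.
by exists s => //; move: n1; rewrite e dotvZl dotvZr m1 mulr1 -expr2.
Qed.

(** Differentiating [dotv (pd j F) N = 0] in direction i moves the second derivative of [F] onto
    [N]. This is why [N] is a field, normal at every point and not only at [x]. *)
Lemma second_fundamental_form_weingarten :
  second_fundamental_form F (N x) x = diag_mx (\row_i (kap 0 i * gam 0 i)).
Proof.
apply/matrixP => i j; rewrite !mxE.
have hF : is_derive x (delta_mx 0 i) (pd j F) (pd i (pd j F) x).
  exact/derivableP/F_derivable.
have hN : is_derive x (delta_mx 0 i) N (pd i N x) by exact/derivableP.
have h := is_derive_dotv hF hN.
have e : (fun y => dotv (pd j F y) (N y)) = cst 0.
  by apply/funext => y; have [_ _ /(_ j)] := N_normal y; rewrite dotvC.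
have : dotv (pd i (pd j F) x) (N x) + dotv (pd j F x) (pd i N x) = 0.
  by rewrite -(derive_val (is_derive := h)) e derive_cst.
move/eqP; rewrite addr_eq0 weingarten dotvZr metric_ij => /eqP ->.
by rewrite eq_sym mulNr opprK; case: eqP => [->|]; rewrite ?mulr1n ?mulr0n ?mulr0.
Qed.

(** All that is known about the value chosen by [get] is that it comes from some unit normal
    [s *: N x] with [s ^+ 2 = 1] and some list of curvatures. Unique factorization of the
    characteristic polynomial makes that list a permutation of the [s * kap 0 i], and squaring
    removes [s]. *)
Lemma sqnormA_weingarten : sqnormA F x = \sum_i kap 0 i ^+ 2.
Proof.
have shapeE (s : R) : shape_operator F (s *: N x) x = diag_mx (s *: kap).
  have -> : shape_operator F (s *: N x) x = s *: shape_operator F (N x) x.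
    rewrite /shape_operator scalemxAr; congr (_ *m _).
    by apply/matrixP => i j; rewrite !mxE dotvZr.
  rewrite /shape_operator second_fundamental_form_weingarten metricE invmx_diag_mx //
    mulmx_diag.
  rewrite -linearZ /=; congr diag_mx; apply/rowP => i; rewrite !mxE.
  by rewrite [_^-1 * _]mulrC mulfK.
have charE (s : R) : char_poly (shape_operator F (s *: N x) x) =
    \prod_i ('X - (s * kap 0 i)%:P).
  rewrite shapeE char_poly_trig ?diag_mx_is_trig //.
  by apply: eq_bigr => i _; rewrite !mxE eqxx mulr1n.
rewrite /sqnormA; set S := (X in get X).
have S0 : S (\sum_i kap 0 i ^+ 2).
  exists (fun i => kap 0 i) => //; exists (N x) => //.
  rewrite -[N x]scale1r charE; apply: eq_bigr => i _; by rewrite mul1r.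
have [kappa [N' /unit_normal_unique [s s1 ->]] + ->] : S (get S).
  by apply: getPex; exists (\sum_i kap 0 i ^+ 2).
rewrite charE => e.
have hp : perm_eq [seq s * kap 0 i | i <- index_enum 'I_d]
               [seq kappa i | i <- index_enum 'I_d].
  by apply: prod_XsubC_eq; rewrite !big_map.
have -> : \sum_i kappa i ^+ 2 = \sum_(z <- map kappa (index_enum 'I_d)) z ^+ 2.
  by rewrite big_map.
rewrite -(perm_big _ hp) big_map.
by apply: eq_bigr => i _; rewrite exprMn s1 mul1r.
Qed.

End OrthogonalCoordinates.

(** * Stereographic coordinates *)

Section Stereographic.
Variables (R : realType) (V : normedModType R) (x v : V).

(** The conformal factor: in the stereographic chart the round metric is its square times the
    Euclidean metric. *)
Definition stereo_factor (k : nat) (p : 'rV[R]_k) : R := 2 / (dotv p p + 1).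

Section Factor.
Variable k : nat.
Implicit Types p q e : 'rV[R]_k.
Local Notation lam := (@stereo_factor k).

Lemma dotvv_add1_neq0 p : dotv p p + 1 != 0.
Proof. by rewrite gt_eqF // ltr_wpDl // dotv_ge0. Qed.

Lemma stereo_factor_gt0 p : 0 < lam p.
Proof. by rewrite divr_gt0 // ltr_wpDl // dotv_ge0. Qed.

Lemma stereo_factor_neq0 p : lam p != 0.
Proof. by rewrite gt_eqF // stereo_factor_gt0. Qed.

(** Eliminates the squared norm of [p], which leaves identities in [lam p] and inner products with
    other vectors. *)
Lemma stereo_factorM p : lam p * dotv p p = 2 - lam p.
Proof. by rewrite /stereo_factor; field; exact: dotvv_add1_neq0. Qed.

Lemma is_derive_stereo_factor (P : V -> 'rV[R]_k) q :
  is_derive x v P q ->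
  is_derive x v (fun y => lam (P y)) (- (lam (P x) ^+ 2 * dotv (P x) q)).
Proof.
move=> hP; have h0 := dotvv_add1_neq0 (P x).
have h1 := is_derive_fD (is_derive_dotv hP hP) (is_derive_cst (1 : R) x v).
have h := is_derive_fM (is_derive_cst (2 : R) x v) (is_derive_fV h1 h0).
apply: (is_derive_eq h).
by rewrite /= (dotvC q) /stereo_factor; field.
Qed.

(* In the stereographic chart the constants ([e = 0], [f = 0]) and the
   coordinates of the sphere ([c = 0]) both have this form. *)
Definition stereo_fun e (f c : R) p : R :=
  lam p * dotv p e + f * (1 - lam p) + c.

Definition stereo_dfun e (f : R) p q : R :=
  lam p ^+ 2 * (f - dotv p e) * dotv p q + lam p * dotv q e.

Lemma is_derive_stereo_fun e f c (P : V -> 'rV[R]_k) q :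
  is_derive x v P q ->
  is_derive x v (fun y => stereo_fun e f c (P y)) (stereo_dfun e f (P x) q).
Proof.
move=> hP; have hl := is_derive_stereo_factor hP.
have he := is_derive_dotv hP (is_derive_cst e x v).
rewrite /stereo_fun; have h1 := is_derive_fD (is_derive_cst (1 : R) x v) (is_derive_fN hl).
have h := is_derive_fD (is_derive_fD (is_derive_fM hl he)
    (is_derive_fM (is_derive_cst f x v) h1)) (is_derive_cst c x v).
apply: (is_derive_eq h).
by rewrite /= dotv0r /stereo_dfun; ring.
Qed.

(** For [m = k], [lam ^+ k] is the volume density of the round sphere and [lam ^- 2] its inverse
    metric; summed over the basis vectors [q], this is the density times the Laplacian of
    [stereo_fun]. *)
Definition stereo_flux_deriv (m : nat) e (f : R) p q : R :=
  lam p ^+ m * ((f - dotv p e) * (dotv q q - m%:R * lam p * dotv p q ^+ 2)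
                - m%:R * dotv p q * dotv q e).

(** The quotient of powers replaces the exponent m - 2, which would be truncated for m = 1, the case
    of circles (n = 2). *)
Lemma is_derive_stereo_flux (m : nat) e f (P : V -> 'rV[R]_k) q :
  is_derive x v P q ->
  is_derive x v
    (fun y => lam (P y) ^+ m / lam (P y) ^+ 2 * stereo_dfun e f (P y) q)
    (stereo_flux_deriv m e f (P x) q).
Proof.
move=> hP; have hl := is_derive_stereo_factor hP.
have l0 := stereo_factor_neq0 (P x).
have he := is_derive_dotv hP (is_derive_cst e x v).
have hq := is_derive_dotv hP (is_derive_cst q x v).
have hm := is_derive_fX m hl l0.
have hi := is_derive_fV hl l0.
have hf := is_derive_fD (is_derive_cst f x v) (is_derive_fN he).
have -> : (fun y => lam (P y) ^+ m / lam (P y) ^+ 2 * stereo_dfun e f (P y) q) =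
  (fun y => lam (P y) ^+ m *
     ((f - dotv (P y) e) * dotv (P y) q + (lam (P y))^-1 * dotv q e)).
  apply/funext => y; rewrite /stereo_dfun.
  by have := stereo_factor_neq0 (P y) => ?; field.
have h := is_derive_fM hm (is_derive_fD (is_derive_fM hf hq)
    (is_derive_fM hi (is_derive_cst (dotv q e) x v))).
apply: (is_derive_eq h).
by rewrite /= !dotv0r /stereo_flux_deriv; field.
Qed.

(* The coordinates are eigenfunctions of the Laplacian of the sphere of
   dimension k, for the eigenvalue -k. *)
Lemma sum_stereo_flux_deriv e f c p :
  \sum_(i < k) stereo_flux_deriv k e f p (delta_mx 0 i) =
  - (k%:R * lam p ^+ k * (stereo_fun e f c p - c)).
Proof.
have hi i : stereo_flux_deriv k e f p (delta_mx 0 i) =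
    lam p ^+ k * (f - dotv p e) +
    (- (k%:R * lam p * lam p ^+ k * (f - dotv p e)) * (p 0 i * p 0 i) +
     - (k%:R * lam p ^+ k) * (p 0 i * e 0 i)).
  rewrite /stereo_flux_deriv (dotvC p (delta_mx 0 i)) !dotv_deltal !mxE !eqxx /=.
  by ring.
rewrite (eq_bigr _ (fun i _ => hi i)) !big_split /= -!mulr_sumr -!dotvE.
rewrite sumr_const card_ord -[_ *+ k]mulr_natr /stereo_fun.
have -> : - (k%:R * lam p * lam p ^+ k * (f - dotv p e)) * dotv p p =
  - (k%:R * lam p ^+ k * (f - dotv p e)) * (lam p * dotv p p) by ring.
by rewrite stereo_factorM; ring.
Qed.

End Factor.

Section Map.
Variables (n : nat) (E : orthoframe R n).
Implicit Types p q : 'rV[R]_n.-1.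

Lemma stereo_vecE p : stereo_vec E p =
  row_mx (stereo_factor p *: p) ((1 - stereo_factor p)%:M : 'M[R]_1) *m sval E.
Proof.
rewrite /stereo_vec scalemxAl scale_row_mx scalerA scale_scalar_mx mulrC.
congr (row_mx _ _%:M *m _); rewrite /stereo_factor.
by have := dotvv_add1_neq0 p => ?; field.
Qed.

Lemma stereo_vec_entry p k : stereo_vec E p 0 k =
  stereo_fun (\row_i sval E (lshift 1 i) k) (sval E (rshift _ 0) k) 0 p.
Proof.
rewrite stereo_vecE mxE big_split_ord /= big_ord1 /stereo_fun addr0 dotvE mulr_sumr.
congr (_ + _); last by rewrite row_mxEr !mxE mulrC.
by apply: eq_bigr => i _; rewrite row_mxEl !mxE mulrA.
Qed.

Lemma dotv_orthoframe (u w : 'rV[R]_(n.-1 + 1)) :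
  dotv (u *m sval E) (w *m sval E) = dotv u w.
Proof.
by rewrite /dotv trmx_mul mulmxA -(mulmxA u) (eqP (svalP E)) mulmx1.
Qed.

Definition stereo_diff p q : 'rV[R]_n :=
  row_mx (stereo_factor p *: q - (stereo_factor p ^+ 2 * dotv p q) *: p)
         ((stereo_factor p ^+ 2 * dotv p q)%:M : 'M[R]_1) *m sval E.

Lemma is_derive_stereo_vec (P : V -> 'rV[R]_n.-1) q :
  is_derive x v P q ->
  is_derive x v (fun y => stereo_vec E (P y)) (stereo_diff (P x) q).
Proof.
move=> hP; under eq_fun do rewrite stereo_vecE.
have hl := is_derive_stereo_factor hP.
have h1 := is_derive_fD (is_derive_cst (1 : R) x v) (is_derive_fN hl).
have h := is_derive_mulmxr (sval E) (is_derive_row_mx (is_derive_scalemx hl hP)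
    (is_derive_scalar_mx 1 h1)).
apply: (is_derive_eq h).
by rewrite opprK add0r scaleNr addrC.
Qed.

Lemma stereo_vec_dotv p : dotv (stereo_vec E p) (stereo_vec E p) = 1.
Proof. exact/eqP/stereo_vec_sphere. Qed.

Lemma stereo_diff_tangent p q : dotv (stereo_vec E p) (stereo_diff p q) = 0.
Proof.
rewrite stereo_vecE dotv_orthoframe dotv_row_mx dotv_scalar_mx.
rewrite -scaleNr dotvZl dotvDr !dotvZr.
have -> : stereo_factor p * (stereo_factor p * dotv p q +
    - (stereo_factor p ^+ 2 * dotv p q) * dotv p p) =
  stereo_factor p ^+ 2 * dotv p q * (1 - stereo_factor p * dotv p p) by ring.
by rewrite stereo_factorM; ring.
Qed.

Lemma stereo_diff_conformal p q q' :
  dotv (stereo_diff p q) (stereo_diff p q') = stereo_factor p ^+ 2 * dotv q q'.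
Proof.
rewrite dotv_orthoframe dotv_row_mx dotv_scalar_mx.
rewrite -!(scaleNr _ p) !(dotvDl, dotvDr, dotvZl, dotvZr) (dotvC q p).
have l0 := stereo_factor_neq0 p.
have -> : dotv p p = (2 - stereo_factor p) / stereo_factor p.
  by rewrite -stereo_factorM mulrAC mulfV // mul1r.
by field.
Qed.

Lemma stereo_diff0 p : stereo_diff p 0 = 0.
Proof. by rewrite /stereo_diff dotv0r mulr0 scaler0 scale0r subr0 raddf0 row_mx0 mul0mx. Qed.

End Map.
End Stereographic.

(** * Warped products of two spheres and a curve *)

(* (fa, fb, fc) is a curve in S^2 parametrized by arc length, (ga, gb, gc) its
   velocity, (na, nb, nc) its normal in S^2 and kap its geodesic curvature;
   [frame_minimal] says that the hypersurface swept out by S^k x S^k is minimal. *)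
Record moving_frame (R : realType) (k : nat) := MovingFrame {
  fa : R -> R; fb : R -> R; fc : R -> R;
  ga : R -> R; gb : R -> R; gc : R -> R;
  na : R -> R; nb : R -> R; nc : R -> R;
  kap : R -> R;
  fa_gt0 : forall t, 0 < fa t;
  fb_gt0 : forall t, 0 < fb t;
  fa_derive : forall t : R, is_derive t 1 fa (ga t);
  fb_derive : forall t : R, is_derive t 1 fb (gb t);
  fc_derive : forall t : R, is_derive t 1 fc (gc t);
  ga_derive : forall t : R, is_derive t 1 ga (kap t * na t - fa t);
  gb_derive : forall t : R, is_derive t 1 gb (kap t * nb t - fb t);
  gc_derive : forall t : R, is_derive t 1 gc (kap t * nc t - fc t);
  na_derive : forall t : R, is_derive t 1 na (- (kap t * ga t));
  nb_derive : forall t : R, is_derive t 1 nb (- (kap t * gb t));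
  nc_derive : forall t : R, is_derive t 1 nc (- (kap t * gc t));
  frame_ff : forall t, fa t * fa t + fb t * fb t + fc t * fc t = 1;
  frame_gg : forall t, ga t * ga t + gb t * gb t + gc t * gc t = 1;
  frame_nn : forall t, na t * na t + nb t * nb t + nc t * nc t = 1;
  frame_fg : forall t, fa t * ga t + fb t * gb t + fc t * gc t = 0;
  frame_fn : forall t, fa t * na t + fb t * nb t + fc t * nc t = 0;
  frame_gn : forall t, ga t * na t + gb t * nb t + gc t * nc t = 0;
  frame_aa : forall t, fa t ^+ 2 + ga t ^+ 2 + na t ^+ 2 = 1;
  frame_bb : forall t, fb t ^+ 2 + gb t ^+ 2 + nb t ^+ 2 = 1;
  frame_ab : forall t, fa t * fb t + ga t * gb t + na t * nb t = 0;
  frame_ac : forall t, fa t * fc t + ga t * gc t + na t * nc t = 0;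
  frame_bc : forall t, fb t * fc t + gb t * gc t + nb t * nc t = 0;
  frame_minimal : forall t, kap t = k%:R * (na t / fa t + nb t / fb t)
}.

Lemma fa_neq0 (R : realType) (k : nat) (M : moving_frame R k) t : fa M t != 0.
Proof. by rewrite gt_eqF // fa_gt0. Qed.

Lemma fb_neq0 (R : realType) (k : nat) (M : moving_frame R k) t : fb M t != 0.
Proof. by rewrite gt_eqF // fb_gt0. Qed.

Section WarpedHypersurface.
Variables (R : realType) (n : nat) (E E' : orthoframe R n).
Variable M : moving_frame R n.-1.
Local Notation k := n.-1.
Local Notation V := 'rV[R]_(n.-1 + n.-1 + 1).
Implicit Types x v w z : V.

Definition coord_p x : 'rV[R]_k := lsubmx (lsubmx x).
Definition coord_q x : 'rV[R]_k := rsubmx (lsubmx x).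
Definition coord_t x : R := rsubmx x 0 0.

Definition dir_p (i : 'I_k) : 'I_(k + k + 1) := lshift 1 (lshift k i).
Definition dir_q (i : 'I_k) : 'I_(k + k + 1) := lshift 1 (rshift k i).
Definition dir_t : 'I_(k + k + 1) := rshift (k + k) 0.

Lemma is_derive_coord_p x v : is_derive x v coord_p (coord_p v).
Proof.
apply: is_derive_mx => i j; rewrite !mxE; under eq_fun do rewrite !mxE.
exact: is_derive_mx_entry (is_derive_id x v).
Qed.

Lemma is_derive_coord_q x v : is_derive x v coord_q (coord_q v).
Proof.
apply: is_derive_mx => i j; rewrite !mxE; under eq_fun do rewrite !mxE.
exact: is_derive_mx_entry (is_derive_id x v).
Qed.

Lemma is_derive_coord_t x v : is_derive x v coord_t (coord_t v).
Proof.
rewrite /coord_t mxE; under eq_fun do rewrite mxE.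
exact: is_derive_mx_entry (is_derive_id x v).
Qed.

Lemma coord_p_line (h : R) v x : coord_p (h *: v + x) = h *: coord_p v + coord_p x.
Proof. by apply/rowP => i; rewrite !mxE. Qed.

Lemma coord_q_line (h : R) v x : coord_q (h *: v + x) = h *: coord_q v + coord_q x.
Proof. by apply/rowP => i; rewrite !mxE. Qed.

Lemma coord_t_line (h : R) v x : coord_t (h *: v + x) = h * coord_t v + coord_t x.
Proof. by rewrite /coord_t !mxE. Qed.

Lemma coord_pp i : coord_p (delta_mx 0 (dir_p i)) = delta_mx 0 i.
Proof. by apply/rowP => j; rewrite !mxE !eqxx /= -val_eqE. Qed.

Lemma coord_pq i : coord_p (delta_mx 0 (dir_q i)) = 0.
Proof.
apply/rowP => j; rewrite !mxE eqxx /= -val_eqE /=.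
by rewrite ltn_eqF // (leq_trans (ltn_ord j)) ?leq_addr.
Qed.

Lemma coord_pt : coord_p (delta_mx 0 dir_t) = 0.
Proof.
apply/rowP => j; rewrite !mxE eqxx /= -val_eqE /= addn0.
by rewrite ltn_eqF // (leq_trans (ltn_ord j)) ?leq_addr.
Qed.

Lemma coord_qp i : coord_q (delta_mx 0 (dir_p i)) = 0.
Proof.
apply/rowP => j; rewrite !mxE eqxx /= -val_eqE /=.
by rewrite gtn_eqF // (leq_trans (ltn_ord i)) ?leq_addr.
Qed.

Lemma coord_qq i : coord_q (delta_mx 0 (dir_q i)) = delta_mx 0 i.
Proof. by apply/rowP => j; rewrite !mxE !eqxx /= -val_eqE /= eqn_add2l. Qed.

Lemma coord_qt : coord_q (delta_mx 0 dir_t) = 0.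
Proof.
apply/rowP => j; rewrite !mxE eqxx /= -val_eqE /= addn0.
by rewrite ltn_eqF // ltn_add2l.
Qed.

Lemma coord_tp i : coord_t (delta_mx 0 (dir_p i)) = 0.
Proof.
rewrite /coord_t !mxE eqxx /= -val_eqE /= addn0.
by rewrite gtn_eqF // (leq_trans (ltn_ord i)) ?leq_addr.
Qed.

Lemma coord_tq i : coord_t (delta_mx 0 (dir_q i)) = 0.
Proof. by rewrite /coord_t !mxE eqxx /= -val_eqE /= addn0 gtn_eqF // ltn_add2l. Qed.

Lemma coord_tt : coord_t (delta_mx 0 dir_t) = 1.
Proof. by rewrite /coord_t !mxE !eqxx. Qed.

Definition coord_deltaE := (coord_pp, coord_pq, coord_pt, coord_qp, coord_qq,
  coord_qt, coord_tp, coord_tq, coord_tt).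

Lemma dirP (P : 'I_(k + k + 1) -> Prop) :
  (forall i, P (dir_p i)) -> (forall i, P (dir_q i)) -> P dir_t ->
  forall i, P i.
Proof.
move=> Pp Pq Pt i; case: (split_ordP i) => j ->; last by rewrite (ord1 j).
by case: (split_ordP j) => l ->; [exact: Pp|exact: Pq].
Qed.

Lemma sum_dir (h : 'I_(k + k + 1) -> R) :
  \sum_i h i = \sum_i h (dir_p i) + \sum_i h (dir_q i) + h dir_t.
Proof. by rewrite big_split_ord big_split_ord big_ord1. Qed.

Lemma sum_dir_eq (h : 'I_(k + k + 1) -> R) hp hq ht :
  (forall i, h (dir_p i) = hp i) -> (forall i, h (dir_q i) = hq i) ->
  h dir_t = ht -> \sum_i h i = \sum_i hp i + \sum_i hq i + ht.
Proof.
move=> ep eq et; rewrite sum_dir et.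
by rewrite (eq_bigr _ (fun i _ => ep i)) (eq_bigr _ (fun i _ => eq i)).
Qed.

Lemma prod_dir (h : 'I_(k + k + 1) -> R) :
  \prod_i h i = \prod_i h (dir_p i) * \prod_i h (dir_q i) * h dir_t.
Proof. by rewrite big_split_ord big_split_ord big_ord1. Qed.

(** The hypersurface and its Gauss map both have this shape, with the position and the normal of the
    curve as profiles. *)
Definition warp (f g h : R -> R) x : 'rV[R]_(n + n + 1) :=
  row_mx (row_mx (f (coord_t x) *: stereo_vec E (coord_p x))
                 (g (coord_t x) *: stereo_vec E' (coord_q x)))
         ((h (coord_t x))%:M : 'M[R]_1).

Definition dwarp (f g df dg dh : R -> R) x v : 'rV[R]_(n + n + 1) :=
  row_mx (row_mx ((df (coord_t x) * coord_t v) *: stereo_vec E (coord_p x)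
                  + f (coord_t x) *: stereo_diff E (coord_p x) (coord_p v))
                 ((dg (coord_t x) * coord_t v) *: stereo_vec E' (coord_q x)
                  + g (coord_t x) *: stereo_diff E' (coord_q x) (coord_q v)))
         ((dh (coord_t x) * coord_t v)%:M : 'M[R]_1).

Lemma is_derive_warp f g h df dg dh x v :
  (forall t : R, is_derive t 1 f (df t)) -> (forall t : R, is_derive t 1 g (dg t)) ->
  (forall t : R, is_derive t 1 h (dh t)) ->
  is_derive x v (warp f g h) (dwarp f g df dg dh x v).
Proof.
move=> hf hg hh.
have ht := is_derive_coord_t x v.
apply: is_derive_row_mx; last exact/is_derive_scalar_mx/is_derive_comp.
apply: is_derive_row_mx; apply: is_derive_scalemx.
- exact: is_derive_comp.
- exact/is_derive_stereo_vec/is_derive_coord_p.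
- exact: is_derive_comp.
- exact/is_derive_stereo_vec/is_derive_coord_q.
Qed.

Lemma dotv_warp f g h f' g' h' x : dotv (warp f g h x) (warp f' g' h' x) =
  f (coord_t x) * f' (coord_t x) + g (coord_t x) * g' (coord_t x)
  + h (coord_t x) * h' (coord_t x).
Proof.
rewrite /warp; move: (stereo_vec E _) (stereo_vec_dotv E (coord_p x)) => S hS.
move: (stereo_vec E' _) (stereo_vec_dotv E' (coord_q x)) => S' hS'.
by rewrite !dotv_row_mx dotv_scalar_mx !dotvZl !dotvZr hS hS' !mulr1.
Qed.

Lemma dotv_warp_dwarp f g h f' g' df dg dh x v :
  dotv (warp f g h x) (dwarp f' g' df dg dh x v) =
  (f (coord_t x) * df (coord_t x) + g (coord_t x) * dg (coord_t x)
   + h (coord_t x) * dh (coord_t x)) * coord_t v.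
Proof.
rewrite /warp /dwarp.
have := stereo_diff_tangent E (coord_p x) (coord_p v).
move: (stereo_vec E _) (stereo_vec_dotv E (coord_p x)) => S hS hT.
have := stereo_diff_tangent E' (coord_q x) (coord_q v).
move: (stereo_vec E' _) (stereo_vec_dotv E' (coord_q x)) => S' hS' hT'.
rewrite !dotv_row_mx dotv_scalar_mx !dotvDr !dotvZl !dotvZr hS hS' hT hT'.
by ring.
Qed.

Lemma dotv_dwarp f g df dg dh x v w :
  dotv (dwarp f g df dg dh x v) (dwarp f g df dg dh x w) =
  (df (coord_t x) * df (coord_t x) + dg (coord_t x) * dg (coord_t x)
   + dh (coord_t x) * dh (coord_t x)) * coord_t v * coord_t w
  + (f (coord_t x) * stereo_factor (coord_p x)) ^+ 2 * dotv (coord_p v) (coord_p w)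
  + (g (coord_t x) * stereo_factor (coord_q x)) ^+ 2 * dotv (coord_q v) (coord_q w).
Proof.
rewrite /dwarp.
have := stereo_diff_tangent E (coord_p x) (coord_p w).
have := stereo_diff_tangent E (coord_p x) (coord_p v).
move: (stereo_vec E _) (stereo_vec_dotv E (coord_p x)) => S hS hTv hTw.
have := stereo_diff_tangent E' (coord_q x) (coord_q w).
have := stereo_diff_tangent E' (coord_q x) (coord_q v).
move: (stereo_vec E' _) (stereo_vec_dotv E' (coord_q x)) => S' hS' hTv' hTw'.
rewrite !dotv_row_mx dotv_scalar_mx !(dotvDr, dotvDl) !dotvZl !dotvZr.
rewrite !(dotvC _ S) !(dotvC _ S') hS hS' hTv hTw hTv' hTw'.
by rewrite !stereo_diff_conformal; ring.
Qed.

Local Notation F := (warp (fa M) (fb M) (fc M)).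
Local Notation dF := (dwarp (fa M) (fb M) (ga M) (gb M) (gc M)).
Local Notation N := (warp (na M) (nb M) (nc M)).

Lemma is_derive_F x v : is_derive x v F (dF x v).
Proof. exact: is_derive_warp (fa_derive M) (fb_derive M) (fc_derive M). Qed.

Lemma is_derive_N x v :
  is_derive x v N (dwarp (na M) (nb M) (fun t => - (kap M t * ga M t))
    (fun t => - (kap M t * gb M t)) (fun t => - (kap M t * gc M t)) x v).
Proof. exact: is_derive_warp (na_derive M) (nb_derive M) (nc_derive M). Qed.

Lemma pdF i x : pd i F x = dF x (delta_mx 0 i).
Proof. by rewrite /pd (derive_val (is_derive := is_derive_F _ _)). Qed.

Definition warp_metric x : V :=
  row_mx (row_mx (const_mx ((fa M (coord_t x) * stereo_factor (coord_p x)) ^+ 2))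
                 (const_mx ((fb M (coord_t x) * stereo_factor (coord_q x)) ^+ 2)))
         (const_mx 1).

Lemma warp_metric_p x i : warp_metric x 0 (dir_p i) =
  (fa M (coord_t x) * stereo_factor (coord_p x)) ^+ 2.
Proof. by rewrite row_mxEl row_mxEl mxE. Qed.

Lemma warp_metric_q x i : warp_metric x 0 (dir_q i) =
  (fb M (coord_t x) * stereo_factor (coord_q x)) ^+ 2.
Proof. by rewrite row_mxEl row_mxEr mxE. Qed.

Lemma warp_metric_t x : warp_metric x 0 dir_t = 1.
Proof. by rewrite row_mxEr mxE. Qed.

Definition warp_metricE := (warp_metric_p, warp_metric_q, warp_metric_t).

Lemma warp_metric_neq0 x i : warp_metric x 0 i != 0.
Proof.
elim/dirP : i => [i|i|]; rewrite warp_metricE ?oner_eq0 // expf_eq0 /=.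
  by rewrite mulf_neq0 ?stereo_factor_neq0 // fa_neq0.
by rewrite mulf_neq0 ?stereo_factor_neq0 // fb_neq0.
Qed.

Lemma metric_warp x : metric F x = diag_mx (warp_metric x).
Proof.
have delta_delta l (i j : 'I_l) :
    dotv (delta_mx 0 i : 'rV[R]_l) (delta_mx 0 j) = (i == j)%:R.
  by rewrite dotv_deltal mxE eqxx.
apply/matrixP => i j; rewrite [LHS]mxE [RHS]mxE !pdF dotv_dwarp frame_gg mul1r.
(* Nine blocks; in the six off-diagonal ones both sides vanish, because the indices lie in disjoint
   ranges. *)
elim/dirP : i => [i|i|]; elim/dirP : j => [j|j|]; rewrite !coord_deltaE warp_metricE.
- by rewrite !mul0r dotv0l mulr0 addr0 add0r delta_delta mulr_natr -!val_eqE.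
- rewrite !(dotv0l, dotv0r, mulr0, mul0r) !addr0 -val_eqE /= ltn_eqF ?mulr0n //.
  by rewrite (leq_trans (ltn_ord i)) ?leq_addr.
- rewrite !(dotv0l, dotv0r, mulr0, mul0r) !addr0 -val_eqE /= addn0 ltn_eqF ?mulr0n //.
  by rewrite (leq_trans (ltn_ord i)) ?leq_addr.
- rewrite !(dotv0l, dotv0r, mulr0, mul0r) !addr0 -val_eqE /= gtn_eqF ?mulr0n //.
  by rewrite (leq_trans (ltn_ord j)) ?leq_addr.
- rewrite !mul0r dotv0l mulr0 add0r add0r delta_delta mulr_natr -!val_eqE /=.
  by rewrite eqn_add2l.
- rewrite !(dotv0l, dotv0r, mulr0, mul0r) !addr0 -val_eqE /= addn0 ltn_eqF ?mulr0n //.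
  by rewrite ltn_add2l.
- rewrite !(dotv0l, dotv0r, mulr0, mul0r) !addr0 -val_eqE /= addn0 gtn_eqF ?mulr0n //.
  by rewrite (leq_trans (ltn_ord j)) ?leq_addr.
- rewrite !(dotv0l, dotv0r, mulr0, mul0r) !addr0 -val_eqE /= addn0 gtn_eqF ?mulr0n //.
  by rewrite ltn_add2l.
- by rewrite dotv0l !mulr0 !addr0 mulr1 eqxx.
Qed.

(** Along a sphere [F] and [N] move the same unit vector, scaled by [fa] and [na] (or [fb] and
    [nb]), whence the ratios; along the curve the normal has derivative [- kap] times the velocity.
    That the entries sum to zero is [frame_minimal]. *)
Definition warp_curvature x : V :=
  row_mx (row_mx (const_mx (- (na M (coord_t x) / fa M (coord_t x))))
                 (const_mx (- (nb M (coord_t x) / fb M (coord_t x)))))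
         (const_mx (kap M (coord_t x))).

Definition frame_sqnormA (t : R) : R :=
  k%:R * ((na M t / fa M t) ^+ 2 + (nb M t / fb M t) ^+ 2) + kap M t ^+ 2.

Lemma pdN i x : pd i N x = - warp_curvature x 0 i *: pd i F x.
Proof.
rewrite pdF /pd (derive_val (is_derive := is_derive_N _ _)) /dwarp.
move: (stereo_vec E _) (stereo_vec E' _) => S S'.
rewrite !scale_row_mx scale_scalar_mx !scalerDr !scalerA.
have a0 := fa_neq0 M (coord_t x).
have b0 := fb_neq0 M (coord_t x).
elim/dirP : i => [i|i|]; rewrite !coord_deltaE !(mulr0, mulr1).

- rewrite row_mxEl row_mxEl mxE !stereo_diff0 opprK divfK // !scaler0 !scale0r.
  by rewrite raddf0.
- rewrite row_mxEl row_mxEr mxE !stereo_diff0 opprK divfK // !scaler0 !scale0r.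
  by rewrite raddf0.
- by rewrite row_mxEr mxE !stereo_diff0 !scaler0 !addr0 !mulNr.
Qed.

(** Second-order derivability is assumed here and supplied by [warp_derivable2], once smooth
    functions are available. *)
Lemma sqnormA_warp x : (0 < n)%N ->
  (forall i j, derivable (pd j F) x (delta_mx 0 i)) ->
  sqnormA F x = frame_sqnormA (coord_t x).
Proof.
move=> n0 dF2.
(* Codimension two in the ambient space; false for [n = 0], where [n.-1] is truncated. *)
have dimE : (n + n + 1 = (k + k + 1).+2)%N by case: (n) n0 => // l _; rewrite /=; lia.
have normalN z : unit_normal F z (N z).
  split; rewrite ?dotv_warp ?frame_nn //.
    by rewrite -[RHS](frame_fn M (coord_t z)); ring.
  move=> i; rewrite pdF dotv_warp_dwarp.
  by rewrite [X in X * _](_ : _ = 0) ?mul0r // -[RHS](frame_gn M (coord_t z)); ring.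
rewrite (@sqnormA_weingarten _ _ _ F N x (warp_metric x) (warp_curvature x)) //.
- rewrite sum_dir [warp_curvature x 0 dir_t]row_mxEr mxE.
  under eq_bigr do rewrite [warp_curvature x 0 _]row_mxEl row_mxEl mxE.
  rewrite sumr_const card_ord.
  under eq_bigr do rewrite [warp_curvature x 0 _]row_mxEl row_mxEr mxE.
  rewrite sumr_const card_ord.
  by rewrite /frame_sqnormA mulrDr !mulr_natl !sqrrN.
- exact: warp_metric_neq0.
- exact: metric_warp.
- by rewrite dotv_warp frame_ff.
- by move=> i; rewrite pdF dotv_warp_dwarp frame_fg mul0r.
- by move=> i; have hN := is_derive_N x (delta_mx 0 i).
- by move=> i; exact: pdN.
Qed.


(** * The Laplacian of functions with separated variables *)

Section Laplacian.
Variables (e e' : 'rV[R]_k) (f f' c c' : R) (G G1 G2 : R -> R).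
Hypothesis G_derive : forall t : R, is_derive t 1 G (G1 t).
Hypothesis G1_derive : forall t : R, is_derive t 1 G1 (G2 t).

Local Notation U := (stereo_fun e f c).
Local Notation W := (stereo_fun e' f' c').
Local Notation lam := stereo_factor.
Local Notation ct := coord_t.

Definition sep_fun z : R := U (coord_p z) * W (coord_q z) * G (ct z).

Lemma is_derive_sep_fun z v : is_derive z v sep_fun
  (stereo_dfun e f (coord_p z) (coord_p v) * W (coord_q z) * G (ct z) +
   U (coord_p z) * stereo_dfun e' f' (coord_q z) (coord_q v) * G (ct z) +
   U (coord_p z) * W (coord_q z) * (G1 (ct z) * ct v)).
Proof.
have h := is_derive_fM (is_derive_fM
  (is_derive_stereo_fun e f c (is_derive_coord_p z v))
  (is_derive_stereo_fun e' f' c' (is_derive_coord_q z v)))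
  (is_derive_comp (is_derive_coord_t z v) (G_derive _)).
by apply: (is_derive_eq h); ring.
Qed.

Definition warp_density z : R :=
  (fa M (ct z) * lam (coord_p z)) ^+ k * (fb M (ct z) * lam (coord_q z)) ^+ k.

Let a0 := fa_neq0 M.
Let b0 := fb_neq0 M.

Lemma warp_density_gt0 z : 0 < warp_density z.
Proof.
by rewrite mulr_gt0 // exprn_gt0 // mulr_gt0 ?fa_gt0 ?fb_gt0 // stereo_factor_gt0.
Qed.

Lemma warp_density_sqr z : warp_density z ^+ 2 = \prod_i warp_metric z 0 i.
Proof.
rewrite prod_dir warp_metric_t mulr1.
rewrite (eq_bigr _ (fun i _ => warp_metric_p z i)).
rewrite (eq_bigr _ (fun i _ => warp_metric_q z i)).
by rewrite !prodr_const !card_ord /warp_density exprMn -!exprM mulnC.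
Qed.

Lemma is_derive_line_cst (h : V -> R) x v :
  (forall s : R, h (s *: v + x) = h x) -> is_derive x v h 0.
Proof.
move=> hx; apply/is_derive_line; under eq_fun do rewrite hx.
exact: is_derive_cst.
Qed.

(** The flux is that of the round sphere in [p] times a factor [K] built from [q] and [t] alone,
    whose derivative along [dir_p i] vanishes. *)
Lemma flux_p i x :
  pd (dir_p i) (fun z => warp_density z / warp_metric z 0 (dir_p i)
                         * pd (dir_p i) sep_fun z) x =
  stereo_flux_deriv k e f (coord_p x) (delta_mx 0 i) *
  (warp_density x / (lam (coord_p x) ^+ k * fa M (ct x) ^+ 2) *
   (W (coord_q x) * G (ct x))).
Proof.
pose K z := fa M (ct z) ^+ k / fa M (ct z) ^+ 2 *
  (fb M (ct z) * lam (coord_q z)) ^+ k * (W (coord_q z) * G (ct z)).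
have -> : (fun z => warp_density z / warp_metric z 0 (dir_p i)
                    * pd (dir_p i) sep_fun z) =
  (fun z => (lam (coord_p z) ^+ k / lam (coord_p z) ^+ 2 *
     stereo_dfun e f (coord_p z) (delta_mx 0 i)) * K z).
  apply/funext => z; rewrite /pd (derive_val (is_derive := is_derive_sep_fun _ _)).
  rewrite !coord_deltaE warp_metricE /K /warp_density exprMn.
  rewrite [stereo_dfun e' _ _ 0]/stereo_dfun dotv0r dotv0l.
  by have := stereo_factor_neq0 (coord_p z) => ?; field; rewrite a0.
have hp := is_derive_coord_p x (delta_mx 0 (dir_p i)); rewrite coord_pp in hp.
have hK : is_derive x (delta_mx 0 (dir_p i)) K 0.
  apply: is_derive_line_cst => s.
  by rewrite /K coord_q_line coord_t_line !coord_deltaE mulr0 scaler0 !add0r.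
have h := is_derive_fM (is_derive_stereo_flux k e f hp) hK.
rewrite /pd (derive_val (is_derive := h)) mulr0 addr0 /K /warp_density.
rewrite [in RHS](exprMn k (fa M _)).
congr (_ * _); have := stereo_factor_neq0 (coord_p x) => l0; field.
by rewrite a0 expf_neq0.
Qed.

Lemma flux_q i x :
  pd (dir_q i) (fun z => warp_density z / warp_metric z 0 (dir_q i)
                         * pd (dir_q i) sep_fun z) x =
  stereo_flux_deriv k e' f' (coord_q x) (delta_mx 0 i) *
  (warp_density x / (lam (coord_q x) ^+ k * fb M (ct x) ^+ 2) *
   (U (coord_p x) * G (ct x))).
Proof.
pose K z := fb M (ct z) ^+ k / fb M (ct z) ^+ 2 *
  (fa M (ct z) * lam (coord_p z)) ^+ k * (U (coord_p z) * G (ct z)).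
have -> : (fun z => warp_density z / warp_metric z 0 (dir_q i)
                    * pd (dir_q i) sep_fun z) =
  (fun z => (lam (coord_q z) ^+ k / lam (coord_q z) ^+ 2 *
     stereo_dfun e' f' (coord_q z) (delta_mx 0 i)) * K z).
  apply/funext => z; rewrite /pd (derive_val (is_derive := is_derive_sep_fun _ _)).
  rewrite !coord_deltaE warp_metricE /K /warp_density [in LHS](exprMn k (fb M _)).
  rewrite [stereo_dfun e _ _ 0]/stereo_dfun dotv0r dotv0l.
  by have := stereo_factor_neq0 (coord_q z) => ?; field; rewrite b0.
have hq := is_derive_coord_q x (delta_mx 0 (dir_q i)); rewrite coord_qq in hq.
have hK : is_derive x (delta_mx 0 (dir_q i)) K 0.
  apply: is_derive_line_cst => s.
  by rewrite /K coord_p_line coord_t_line !coord_deltaE mulr0 scaler0 !add0r.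
have h := is_derive_fM (is_derive_stereo_flux k e' f' hq) hK.
rewrite /pd (derive_val (is_derive := h)) mulr0 addr0 /K /warp_density.
rewrite [in RHS](exprMn k (fb M _)).
congr (_ * _); have := stereo_factor_neq0 (coord_q x) => l0; field.
by rewrite b0 expf_neq0.
Qed.

(** The first-order term is the logarithmic derivative in t of the density, in which t enters
    through [(fa * fb) ^+ k]. *)
Lemma flux_t x :
  pd dir_t (fun z => warp_density z / warp_metric z 0 dir_t
                     * pd dir_t sep_fun z) x =
  warp_density x * (U (coord_p x) * W (coord_q x) * (G2 (ct x) +
    k%:R * (ga M (ct x) / fa M (ct x) + gb M (ct x) / fb M (ct x)) * G1 (ct x))).
Proof.
pose K z := lam (coord_p z) ^+ k * lam (coord_q z) ^+ k *
  (U (coord_p z) * W (coord_q z)).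
have -> : (fun z => warp_density z / warp_metric z 0 dir_t
                    * pd dir_t sep_fun z) =
  (fun z => K z * (fa M (ct z) ^+ k * fb M (ct z) ^+ k * G1 (ct z))).
  apply/funext => z; rewrite /pd (derive_val (is_derive := is_derive_sep_fun _ _)).
  rewrite !coord_deltaE warp_metricE /K /warp_density !exprMn /stereo_dfun.
  by rewrite !(dotv0r, dotv0l); field.
have ht := is_derive_coord_t x (delta_mx 0 dir_t); rewrite coord_tt in ht.
have hK : is_derive x (delta_mx 0 dir_t) K 0.
  apply: is_derive_line_cst => s.
  by rewrite /K coord_p_line coord_q_line !coord_deltaE scaler0 !add0r.
have ha := is_derive_fX k (is_derive_comp ht (fa_derive M _)) (a0 _).
have hb := is_derive_fX k (is_derive_comp ht (fb_derive M _)) (b0 _).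
have hG := is_derive_comp ht (G1_derive _).
have h := is_derive_fM hK (is_derive_fM (is_derive_fM ha hb) hG).
rewrite /pd (derive_val (is_derive := h)) /K /warp_density !exprMn.
by field; rewrite a0 b0.
Qed.

(** On the unit sphere [U - c] is an eigenfunction for the eigenvalue -k, and rescaling the sphere
    by [fa] divides this by [fa ^+ 2]; likewise for [W] and [fb]. *)
Lemma laplace_beltrami_sep_fun x : laplace_beltrami F sep_fun x =
  - (k%:R / fa M (ct x) ^+ 2 * (U (coord_p x) - c) * W (coord_q x) * G (ct x))
  - (k%:R / fb M (ct x) ^+ 2 * U (coord_p x) * (W (coord_q x) - c') * G (ct x))
  + U (coord_p x) * W (coord_q x) * (G2 (ct x) +
    k%:R * (ga M (ct x) / fa M (ct x) + gb M (ct x) / fb M (ct x)) * G1 (ct x)).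
Proof.
rewrite (@laplace_beltrami_orthogonal _ _ _ F warp_metric warp_density); first last.
- exact: warp_density_sqr.
- exact: metric_warp.
- by move=> z; exact/ltW/warp_density_gt0.
- exact: warp_metric_neq0.
rewrite (sum_dir_eq (h := fun j => pd j (fun z =>
    warp_density z / warp_metric z 0 j * pd j sep_fun z) x)
  (flux_p^~ x) (flux_q^~ x) (flux_t x)).
rewrite -!mulr_suml (sum_stereo_flux_deriv e f c) (sum_stereo_flux_deriv e' f' c').
have w0 : warp_density x != 0 by rewrite gt_eqF // warp_density_gt0.
have l0 := stereo_factor_neq0 (coord_p x).
have m0 := stereo_factor_neq0 (coord_q x).
by field; rewrite !a0 !b0 w0 !expf_neq0.
Qed.

End Laplacian.
End WarpedHypersurface.

(** * Smoothness *)

Section GeneratedAlgebra.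
Variables (R : realType) (d : nat) (G : ('rV[R]_d -> R) -> Prop).

(** An inductive predicate, so that closure under differentiation follows by induction from the sum,
    product and quotient rules as soon as it holds for the generators. Every iterated derivative is
    then a differentiable member. *)
Inductive gen_alg : ('rV[R]_d -> R) -> Prop :=
  | Gen_cst (c : R) : gen_alg (fun=> c)
  | Gen_base f : G f -> gen_alg f
  | Gen_add f g : gen_alg f -> gen_alg g -> gen_alg (fun x => f x + g x)
  | Gen_mul f g : gen_alg f -> gen_alg g -> gen_alg (fun x => f x * g x)
  | Gen_inv f : gen_alg f -> (forall x, f x != 0) -> gen_alg (fun x => (f x)^-1).

Lemma gen_alg_sum (I : finType) (f : I -> 'rV[R]_d -> R) :
  (forall i, gen_alg (f i)) -> gen_alg (fun x => \sum_i f i x).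
Proof.
move=> hf.
have -> : (fun x => \sum_i f i x) = \sum_i f i.
  by apply/funext => y; rewrite fct_sumE.
apply: big_ind => //; first exact: Gen_cst.
by move=> *; apply: Gen_add.
Qed.

Lemma gen_alg_exp f m : gen_alg f -> gen_alg (fun x => f x ^+ m).
Proof.
move=> hf; elim: m => [|m IH].
  by under eq_fun do rewrite expr0; exact: Gen_cst.
by under eq_fun do rewrite exprS; exact: Gen_mul.
Qed.

Hypothesis G_differentiable : forall f, G f -> forall x, differentiable f x.
Hypothesis G_derive : forall f v, G f -> gen_alg ('D_v f).

Lemma gen_alg_differentiable f x : gen_alg f -> differentiable f x.
Proof.
move=> hf; elim: hf => [c|{}f /G_differentiable|{}f g _ hf _ hg|{}f g _ hf _ hg|{}f _ hf f0] //.
- exact: differentiableD.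
- exact: differentiableM.
- exact: differentiableV.
Qed.

Lemma gen_alg_derivable f x v : gen_alg f -> derivable f x v.
Proof. by move=> /(@gen_alg_differentiable _ x); exact: diff_derivable. Qed.

Lemma gen_alg_derive f v : gen_alg f -> gen_alg ('D_v f).
Proof.
move=> hf; elim: hf => [c|{}f /G_derive|{}f g hf hf' hg hg'|{}f g hf hf' hg hg'|{}f hf hf' f0].
- have -> : 'D_v (fun=> c) = (fun=> 0) :> ('rV[R]_d -> R).
    by apply/funext => x; rewrite derive_cst.
  exact: Gen_cst.
- exact.
- have -> : 'D_v (fun x => f x + g x) = (fun x => 'D_v f x + 'D_v g x).
    by apply/funext => x; rewrite deriveD //; exact: gen_alg_derivable.
  exact: Gen_add.
- have -> : 'D_v (fun x => f x * g x) = (fun x => 'D_v f x * g x + f x * 'D_v g x).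
    apply/funext => x.
    have df : is_derive x v f ('D_v f x) by exact/derivableP/gen_alg_derivable.
    have dg : is_derive x v g ('D_v g x) by exact/derivableP/gen_alg_derivable.
    by rewrite (derive_val (is_derive := is_derive_fM df dg)).
  by apply: Gen_add; apply: Gen_mul.
- have -> : 'D_v (fun x => (f x)^-1) = (fun x => -1 * ('D_v f x * ((f x)^-1 * (f x)^-1))).
    apply/funext => x.
    have df : is_derive x v f ('D_v f x) by exact/derivableP/gen_alg_derivable.
    rewrite (derive_val (is_derive := is_derive_fV df (f0 x))).
    by rewrite mulN1r expr2 invfM.
  apply: Gen_mul; first exact: Gen_cst.
  by apply: Gen_mul => //; apply: Gen_mul; apply: Gen_inv.
Qed.

Lemma gen_alg_smooth f : gen_alg f -> smooth f.
Proof.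
move=> hf vs x; apply: gen_alg_differentiable.
by elim: vs => //= v vs; exact: gen_alg_derive.
Qed.

End GeneratedAlgebra.

(** * Smoothness and the stability operator for a moving frame *)

Section FrameFunctions.
Variables (R : realType) (n : nat) (M : moving_frame R n.-1).
Local Notation k := n.-1.
Local Notation V := 'rV[R]_(n.-1 + n.-1 + 1).

(** The curvature [kap] is not among the generators: minimality makes it rational in them
    ([alg_kap]), and this closes the frame equations under differentiation. *)
Inductive frame_gen : (V -> R) -> Prop :=
  | Frame_coord i : frame_gen (fun x => x 0 i)
  | Frame_fa : frame_gen (fun x => fa M (coord_t x))
  | Frame_fb : frame_gen (fun x => fb M (coord_t x))
  | Frame_fc : frame_gen (fun x => fc M (coord_t x))
  | Frame_ga : frame_gen (fun x => ga M (coord_t x))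
  | Frame_gb : frame_gen (fun x => gb M (coord_t x))
  | Frame_gc : frame_gen (fun x => gc M (coord_t x))
  | Frame_na : frame_gen (fun x => na M (coord_t x))
  | Frame_nb : frame_gen (fun x => nb M (coord_t x))
  | Frame_nc : frame_gen (fun x => nc M (coord_t x)).

Local Notation alg := (gen_alg frame_gen).

Let a0 := fa_neq0 M.
Let b0 := fb_neq0 M.

Lemma alg_kap : alg (fun x => kap M (coord_t x)).
Proof.
under eq_fun do rewrite frame_minimal.
apply: Gen_mul; first exact: Gen_cst.
apply: Gen_add; apply: Gen_mul.
- exact/Gen_base/Frame_na.
- by apply: Gen_inv => //; exact/Gen_base/Frame_fa.
- exact/Gen_base/Frame_nb.
- by apply: Gen_inv => //; exact/Gen_base/Frame_fb.
Qed.

Lemma differentiable_comp_coord_t (h h' : R -> R) (x : V) :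
  (forall t : R, is_derive t 1 h (h' t)) ->
  differentiable (fun x => h (coord_t x)) x.
Proof.
move=> hh; have dt : differentiable (@coord_t R n) x.
  have -> : @coord_t R n = (fun x : V => x 0 (dir_t n)).
    by apply/funext => y; rewrite /coord_t mxE.
  exact: differentiable_coord.
have dh : differentiable h (coord_t x).
  by apply/derivable1_diffP; have := hh (coord_t x).
exact: differentiable_comp dt dh.
Qed.

Lemma derive_comp_coord_t (h h' : R -> R) (v : V) :
  (forall t : R, is_derive t 1 h (h' t)) ->
  'D_v (fun x => h (coord_t x)) = (fun x => h' (coord_t x) * coord_t v).
Proof.
move=> hh; apply/funext => x.
by rewrite (derive_val (is_derive := is_derive_comp (is_derive_coord_t x v) (hh _))).
Qed.

Lemma frame_gen_differentiable f : frame_gen f -> forall x, differentiable f x.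
Proof.
case=> [i|||||||||] x; first exact: differentiable_coord.
- exact: differentiable_comp_coord_t (fa_derive M).
- exact: differentiable_comp_coord_t (fb_derive M).
- exact: differentiable_comp_coord_t (fc_derive M).
- exact: differentiable_comp_coord_t (ga_derive M).
- exact: differentiable_comp_coord_t (gb_derive M).
- exact: differentiable_comp_coord_t (gc_derive M).
- exact: differentiable_comp_coord_t (na_derive M).
- exact: differentiable_comp_coord_t (nb_derive M).
- exact: differentiable_comp_coord_t (nc_derive M).
Qed.

Lemma frame_gen_derive f v : frame_gen f -> alg ('D_v f).
Proof.
have algM (h h' : R -> R) : (forall t : R, is_derive t 1 h (h' t)) ->
    alg (fun x => h' (coord_t x)) -> alg ('D_v (fun x => h (coord_t x))).
  by move=> hh ah; rewrite (derive_comp_coord_t _ hh); apply: Gen_mul => //; exact: Gen_cst.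
have algB (h h' : V -> R) : alg h -> alg h' ->
    alg (fun x => kap M (coord_t x) * h x - h' x).
  move=> ah ah'; apply: Gen_add; first by apply: Gen_mul => //; exact: alg_kap.
  under eq_fun do rewrite -mulN1r.
  by apply: Gen_mul => //; exact: Gen_cst.
have algN (h : V -> R) : alg h -> alg (fun x => - (kap M (coord_t x) * h x)).
  move=> ah; under eq_fun do rewrite -mulN1r.
  apply: Gen_mul; first exact: Gen_cst.
  by apply: Gen_mul => //; exact: alg_kap.
case=> [i|||||||||].
- have -> : 'D_v (fun x : V => x 0 i) = (fun=> v 0 i).
    apply/funext => x.
    by rewrite (derive_val (is_derive := is_derive_mx_entry 0 i (is_derive_id x v))).
  exact: Gen_cst.
- by apply: algM (fa_derive M) _; exact/Gen_base/Frame_ga.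
- by apply: algM (fb_derive M) _; exact/Gen_base/Frame_gb.
- by apply: algM (fc_derive M) _; exact/Gen_base/Frame_gc.
- apply: algM (ga_derive M) _; apply: algB; apply: Gen_base.
  + exact: Frame_na.
  + exact: Frame_fa.
- apply: algM (gb_derive M) _; apply: algB; apply: Gen_base.
  + exact: Frame_nb.
  + exact: Frame_fb.
- apply: algM (gc_derive M) _; apply: algB; apply: Gen_base.
  + exact: Frame_nc.
  + exact: Frame_fc.
- by apply: algM (na_derive M) _; apply: algN; exact/Gen_base/Frame_ga.
- by apply: algM (nb_derive M) _; apply: algN; exact/Gen_base/Frame_gb.
- by apply: algM (nc_derive M) _; apply: algN; exact/Gen_base/Frame_gc.
Qed.

Lemma alg_smooth f : alg f -> smooth f.
Proof. exact: gen_alg_smooth frame_gen_differentiable frame_gen_derive _. Qed.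

Lemma alg_stereo_fun (P : V -> 'rV[R]_k) e f c :
  (forall i, alg (fun x => P x 0 i)) -> alg (fun x => stereo_fun e f c (P x)).
Proof.
move=> hP.
have hdot (Q : V -> 'rV[R]_k) : (forall i, alg (fun x => Q x 0 i)) ->
    alg (fun x => dotv (P x) (Q x)).
  move=> hQ; under eq_fun do rewrite dotvE.
  by apply: gen_alg_sum => i; apply: Gen_mul.
have hl : alg (fun x => stereo_factor (P x)).
  apply: Gen_mul; first exact: Gen_cst.
  apply: Gen_inv => [|x]; last exact: dotvv_add1_neq0.
  by apply: Gen_add; [exact: hdot|exact: Gen_cst].
apply: Gen_add; last exact: Gen_cst.
apply: Gen_add.
  by apply: Gen_mul => //; apply: hdot => i; exact: Gen_cst.
apply: Gen_mul; first exact: Gen_cst.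
under eq_fun do rewrite -mulN1r.
apply: Gen_add; first exact: Gen_cst.
by apply: Gen_mul => //; exact: Gen_cst.
Qed.

Lemma alg_coord_p i : alg (fun x => coord_p x 0 i).
Proof. by under eq_fun do rewrite !mxE; exact/Gen_base/Frame_coord. Qed.

Lemma alg_coord_q i : alg (fun x => coord_q x 0 i).
Proof. by under eq_fun do rewrite !mxE; exact/Gen_base/Frame_coord. Qed.

Lemma alg_sep_fun e e' f f' c c' (G : R -> R) : alg (fun x => G (coord_t x)) ->
  alg (sep_fun e e' f f' c c' G).
Proof.
move=> hG; apply: Gen_mul => //; apply: Gen_mul; apply: alg_stereo_fun.
- exact: alg_coord_p.
- exact: alg_coord_q.
Qed.

Variables E E' : orthoframe R n.
Local Notation F := (warp E E' (fa M) (fb M) (fc M)).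

Lemma warp_derivable2 i j x : derivable (pd j F) x (delta_mx 0 i).
Proof.
have hF l : alg (fun x => F x 0 l).
  case: (split_ordP l) => l1 ->; last first.
    have -> : (fun x => F x 0 (rshift (n + n) l1)) = (fun x => fc M (coord_t x)).
      by apply/funext => y; rewrite row_mxEr mxE (ord1 l1) eqxx mulr1n.
    exact/Gen_base/Frame_fc.
  case: (split_ordP l1) => l2 ->.
    under eq_fun do rewrite row_mxEl row_mxEl mxE stereo_vec_entry.
    apply: Gen_mul; first exact/Gen_base/Frame_fa.
    exact: alg_stereo_fun alg_coord_p.
  under eq_fun do rewrite row_mxEl row_mxEr mxE stereo_vec_entry.
  apply: Gen_mul; first exact/Gen_base/Frame_fb.
  exact: alg_stereo_fun alg_coord_q.
have der f y v : alg f -> derivable f y v.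
  exact: gen_alg_derivable frame_gen_differentiable _ _ _.
apply/derivable_mxP => i0 l; rewrite (ord1 i0).
have -> : (fun y => pd j F y 0 l) = 'D_(delta_mx 0 j) (fun y => F y 0 l).
  apply/funext => y; rewrite /pd derive_mx ?mxE //.
  by have := is_derive_F E E' M y (delta_mx 0 j).
by apply: der; apply: gen_alg_derive frame_gen_differentiable frame_gen_derive _ _ _.
Qed.

(** The radial form of Delta u + |A|^2 u = 0. Each boolean tells whether the factor on that sphere
    is a coordinate, with eigenvalue k, or the constant 1. *)
Definition frame_laplace (eps eps' : bool) (G G1 G2 : R -> R) (t : R) : Prop :=
  G2 t + k%:R * (ga M t / fa M t + gb M t / fb M t) * G1 t =
  (k%:R * eps%:R / fa M t ^+ 2 + k%:R * eps'%:R / fb M t ^+ 2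
   - frame_sqnormA M t) * G t.

Lemma stability_operator_sep_fun (eps eps' : bool) e e' f f' c c'
    (G G1 G2 : R -> R) x : (0 < n)%N ->
  (forall t : R, is_derive t 1 G (G1 t)) ->
  (forall t : R, is_derive t 1 G1 (G2 t)) ->
  (forall t : R, frame_laplace eps eps' G G1 G2 t) ->
  (forall p, stereo_fun e f c p - c = eps%:R * stereo_fun e f c p) ->
  (forall q, stereo_fun e' f' c' q - c' = eps'%:R * stereo_fun e' f' c' q) ->
  stability_operator F (sep_fun e e' f f' c c' G) x =
  - (2 * n%:R - 1) * sep_fun e e' f f' c c' G x.
Proof.
move=> n0 hG hG1 hL hU hW.
rewrite /stability_operator (laplace_beltrami_sep_fun E E' M _ _ _ _ _ _ hG hG1).
rewrite hL sqnormA_warp //; last by move=> i j; exact: warp_derivable2.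
rewrite hU hW /sep_fun.
have -> : (k + k + 1)%:R = 2 * n%:R - 1 :> R.
  by rewrite -(prednK n0) /= !natrD -addn1 natrD; ring.
by ring.
Qed.

End FrameFunctions.

(** * The eigenfunctions *)

Section FrameJacobiFunctions.
Variables (R : realType) (n : nat) (M : moving_frame R n.-1).
Local Notation k := n.-1.
Implicit Types t : R.

Let a0 := fa_neq0 M.
Let b0 := fb_neq0 M.

(** Obtained by differentiating the minimality relation: (na / fa)' = - (ga / fa) (kap + na / fa),
    and likewise for b. *)
Definition dkap t : R := - k%:R *
  (ga M t / fa M t * (kap M t + na M t / fa M t)
   + gb M t / fb M t * (kap M t + nb M t / fb M t)).

Lemma kap_derive t : is_derive t 1 (kap M) (dkap t).
Proof.
have -> : kap M = (fun t => k%:R * (na M t / fa M t + nb M t / fb M t)).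
  by apply/funext => s; rewrite frame_minimal.
have ha := is_derive_fM (na_derive M t) (is_derive_fV (fa_derive M t) (a0 t)).
have hb := is_derive_fM (nb_derive M t) (is_derive_fV (fb_derive M t) (b0 t)).
have h := is_derive_fM (is_derive_cst (k%:R : R) t 1) (is_derive_fD ha hb).
apply: (is_derive_eq h); rewrite /dkap /=.
by field; rewrite a0 b0.
Qed.


Lemma frame_laplace_na t : frame_laplace M true false (na M)
  (fun s => - (kap M s * ga M s))
  (fun s => - (dkap s * ga M s + kap M s * (kap M s * na M s - fa M s))) t.
Proof.
apply/eqP; rewrite -subr_eq0; apply/eqP.
(* The terms in [kap ^+ 2] and in [kap * ga] cancel. Expanding the remaining [kap * fa] by
   minimality and collecting the coefficients of [na / fa ^+ 2] and [nb / fb ^+ 2] leaves exactly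
   two column relations of the frame. *)
transitivity (k%:R * (na M t / fa M t) / fa M t
      * (fa M t ^+ 2 + ga M t ^+ 2 + na M t ^+ 2 - 1)
    + k%:R * (nb M t / fb M t) / fb M t
      * (fa M t * fb M t + ga M t * gb M t + na M t * nb M t)).
  rewrite /dkap /frame_sqnormA !frame_minimal /=.
  by field; rewrite a0 b0.
by rewrite frame_aa frame_ab subrr !mulr0 addr0.
Qed.

Lemma frame_laplace_nb t : frame_laplace M false true (nb M)
  (fun s => - (kap M s * gb M s))
  (fun s => - (dkap s * gb M s + kap M s * (kap M s * nb M s - fb M s))) t.
Proof.
apply/eqP; rewrite -subr_eq0; apply/eqP.
transitivity (k%:R * (nb M t / fb M t) / fb M t
      * (fb M t ^+ 2 + gb M t ^+ 2 + nb M t ^+ 2 - 1)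
    + k%:R * (na M t / fa M t) / fa M t
      * (fa M t * fb M t + ga M t * gb M t + na M t * nb M t)).
  rewrite /dkap /frame_sqnormA !frame_minimal /=.
  by field; rewrite a0 b0.
by rewrite frame_bb frame_ab subrr !mulr0 addr0.
Qed.

Lemma frame_laplace_nc t : frame_laplace M false false (nc M)
  (fun s => - (kap M s * gc M s))
  (fun s => - (dkap s * gc M s + kap M s * (kap M s * nc M s - fc M s))) t.
Proof.
apply/eqP; rewrite -subr_eq0; apply/eqP.
transitivity (k%:R * (na M t / fa M t) / fa M t
      * (fa M t * fc M t + ga M t * gc M t + na M t * nc M t)
    + k%:R * (nb M t / fb M t) / fb M t
      * (fb M t * fc M t + gb M t * gc M t + nb M t * nc M t)).
  rewrite /dkap /frame_sqnormA !frame_minimal /=.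
  by field; rewrite a0 b0.
by rewrite frame_ac frame_bc !mulr0 addr0.
Qed.

Definition inv_density t : R := (fa M t ^+ k * fb M t ^+ k)^-1.

Definition inv_density1 t : R :=
  - k%:R * (ga M t / fa M t + gb M t / fb M t) * inv_density t.

Definition inv_density2 t : R :=
  - k%:R * ((kap M t * na M t - fa M t) / fa M t - (ga M t / fa M t) ^+ 2
            + ((kap M t * nb M t - fb M t) / fb M t - (gb M t / fb M t) ^+ 2))
    * inv_density t
  - k%:R * (ga M t / fa M t + gb M t / fb M t) * inv_density1 t.

Lemma inv_density_derive t : is_derive t 1 inv_density (inv_density1 t).
Proof.
have ha := is_derive_fX k (fa_derive M t) (a0 t).
have hb := is_derive_fX k (fb_derive M t) (b0 t).
have ab0 : fa M t ^+ k * fb M t ^+ k != 0 by rewrite mulf_neq0 // expf_neq0.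
have h := is_derive_fV (is_derive_fM ha hb) ab0.
apply: (is_derive_eq h); rewrite /inv_density1 /inv_density.
by field; rewrite a0 b0 !expf_neq0.
Qed.

Lemma inv_density1_derive t : is_derive t 1 inv_density1 (inv_density2 t).
Proof.
have ha := is_derive_fM (ga_derive M t) (is_derive_fV (fa_derive M t) (a0 t)).
have hb := is_derive_fM (gb_derive M t) (is_derive_fV (fb_derive M t) (b0 t)).
have h := is_derive_fM (is_derive_fM (is_derive_cst (- k%:R : R) t 1)
  (is_derive_fD ha hb)) (inv_density_derive t).
apply: (is_derive_eq h); rewrite /inv_density2 /=.
by field; rewrite a0 b0.
Qed.

(** With w = (fa fb)^k and G = 1/w, the radial operator is (w G')' / w = - (log w)'' G, so the
    first-order terms disappear. The frame equations and minimality turn - (log w)'' into 2k + k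
    ((ga/fa)^2 + (gb/fb)^2) - kap^2, whose last term cancels against the one in |A|^2. *)
Lemma frame_laplace_inv_density t :
  frame_laplace M true true inv_density inv_density1 inv_density2 t.
Proof.
apply/eqP; rewrite -subr_eq0; apply/eqP.
transitivity (k%:R * inv_density t *
    ((fa M t ^+ 2 + ga M t ^+ 2 + na M t ^+ 2 - 1) / fa M t ^+ 2
     + (fb M t ^+ 2 + gb M t ^+ 2 + nb M t ^+ 2 - 1) / fb M t ^+ 2)).
  rewrite /inv_density2 /inv_density1 /frame_sqnormA !frame_minimal /=.
  by field; rewrite a0 b0.
by rewrite frame_aa frame_bb subrr !mul0r addr0 mulr0.
Qed.

Definition jacobi_profile (eps eps' : bool) : R -> R :=
  if eps then if eps' then inv_density else na M
  else if eps' then nb M else nc M.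

Lemma jacobi_profileP eps eps' : exists G1 G2 : R -> R,
  [/\ forall t : R, is_derive t 1 (jacobi_profile eps eps') (G1 t),
      forall t : R, is_derive t 1 G1 (G2 t) &
      forall t : R, frame_laplace M eps eps' (jacobi_profile eps eps') G1 G2 t].
Proof.
have derN (g dg : R -> R) : (forall t : R, is_derive t 1 g (dg t)) -> forall t : R,
    is_derive t 1 (fun s => - (kap M s * g s)) (- (dkap t * g t + kap M t * dg t)).
  by move=> hg t; exact: is_derive_fN (is_derive_fM (kap_derive t) (hg t)).
case: eps eps' => [] [].
- exists inv_density1, inv_density2; split.
  + exact: inv_density_derive.
  + exact: inv_density1_derive.
  + exact: frame_laplace_inv_density.
- do 2 eexists; split; last exact: frame_laplace_na.
  + exact: na_derive.
  + exact: derN (ga_derive M).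
- do 2 eexists; split; last exact: frame_laplace_nb.
  + exact: nb_derive.
  + exact: derN (gb_derive M).
- do 2 eexists; split; last exact: frame_laplace_nc.
  + exact: nc_derive.
  + exact: derN (gc_derive M).
Qed.

Lemma alg_jacobi_profile eps eps' :
  gen_alg (frame_gen M) (fun x => jacobi_profile eps eps' (coord_t x)).
Proof.
case: eps eps' => [] [] /=.
- apply: Gen_inv => [|x]; last by rewrite mulf_neq0 // expf_neq0.
  apply: Gen_mul; apply: gen_alg_exp; apply: Gen_base; first exact: Frame_fa.
  exact: Frame_fb.
- exact/Gen_base/Frame_na.
- exact/Gen_base/Frame_nb.
- exact/Gen_base/Frame_nc.
Qed.

Definition sphere_coord (o : option 'I_n) (y : sphere R n) : R :=
  if o is Some i then sval y 0 i else 1.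

(** The components of [o] are coerced to booleans to select the profile: [Some] is a coordinate,
    [None] the constant 1. *)
Definition eigenfunction (o : option 'I_n * option 'I_n) (u : mfd R n) : R :=
  let: (y, z, t) := u in
  sphere_coord o.1 y * sphere_coord o.2 z * jacobi_profile o.1 o.2 t.

Lemma sphere_coord_stereo (E : orthoframe R n) (o : option 'I_n) :
  exists e f c, (forall p, sphere_coord o (stereo E p) = stereo_fun e f c p) /\
    forall p, stereo_fun e f c p - c = (o : bool)%:R * stereo_fun e f c p.
Proof.
case: o => [i|].
  exists (\row_j sval E (lshift 1 j) i), (sval E (rshift _ 0) i), 0; split => p.
    exact: stereo_vec_entry.
  by rewrite subr0 mul1r.
exists 0, 0, 1; split => p; rewrite /stereo_fun dotv0r.
  by rewrite mulr0 mul0r !add0r.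
by rewrite mulr0 !mul0r !add0r subrr.
Qed.

Lemma eigenfunction_in (T : R) (X : mfd R n -> 'rV[R]_(n + n + 1)) o :
  (0 < n)%N ->
  (forall E E', X \o chart E E' = warp E E' (fa M) (fb M) (fc M)) ->
  (forall eps eps' t, jacobi_profile eps eps' (t + T) = jacobi_profile eps eps' t) ->
  stability_eigenspace T X (- (2 * n%:R - 1)) (eigenfunction o).
Proof.
move=> n0 hX hT.
have hchart E E' : exists e e' f f' c c', [/\
    eigenfunction o \o chart E E' = sep_fun e e' f f' c c' (jacobi_profile o.1 o.2),
    forall p, stereo_fun e f c p - c = (o.1 : bool)%:R * stereo_fun e f c p &
    forall p, stereo_fun e' f' c' p - c' = (o.2 : bool)%:R * stereo_fun e' f' c' p].
  have [e [f [c [he hc]]]] := sphere_coord_stereo E o.1.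
  have [e' [f' [c' [he' hc']]]] := sphere_coord_stereo E' o.2.
  exists e, e', f, f', c, c'; split=> //.
  by apply/funext => x; rewrite /sep_fun -he -he'.
split; first split.
- by move=> y z t; rewrite /eigenfunction hT.
- move=> E E'; have [e [e' [f [f' [c [c' [-> _ _]]]]]]] := hchart E E'.
  by apply: (alg_smooth (M := M)); apply/alg_sep_fun/alg_jacobi_profile.
- move=> E E' x; have [e [e' [f [f' [c [c' [h hc hc']]]]]]] := hchart E E'.
  have [G1 [G2 [hG hG1 hL]]] := jacobi_profileP o.1 o.2.
  have -> : (- (2 * n%:R - 1) *: eigenfunction o) (chart E E' x) =
    - (2 * n%:R - 1) * (eigenfunction o \o chart E E') x by [].
  rewrite hX h.
  by rewrite (stability_operator_sep_fun E E' x n0 hG hG1 hL hc hc').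
Qed.

End FrameJacobiFunctions.

(** * Linear independence *)

Lemma dim_at_least_card (R : realType) (V : lmodType R) (S : set V) (I : finType)
    (m : nat) (f : I -> V) :
  #|I| = m -> (forall i, S (f i)) ->
  (forall c : I -> R, \sum_i c i *: f i = 0 -> forall i, c i = 0) ->
  dim_at_least m S.
Proof.
move=> <- Sf free; exists (fun i => f (enum_val i)); split=> // c hc i.
rewrite -[i]enum_valK; apply: (free (fun j => c (enum_rank j))).
rewrite -[RHS]hc (reindex enum_rank) /=.
  by apply: eq_bigr => j _; rewrite enum_rankK.
exact/onW_bij/enum_rank_bij.
Qed.

(** Evaluation at the two poles of the i-th axis gives c_None + c_i = 0 = c_None - c_i; [0 < n]
    provides an axis for the constant term. *)
Lemma sphere_coord_free (R : realType) (n : nat) (c : option 'I_n -> R) :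
  (0 < n)%N ->
  (forall y : sphere R n, \sum_o c o * sphere_coord o y = 0) ->
  forall o, c o = 0.
Proof.
move=> n0 hc.
have h (s : R) (i : 'I_n) : s * s = 1 -> c None + c (Some i) * s = 0.
  move=> ss; have hs : dotv (s *: delta_mx 0 i : 'rV[R]_n) (s *: delta_mx 0 i) == 1.
    by rewrite dotvZl dotvZr dotv_deltal mxE !eqxx mulr1 ss.
  rewrite -[RHS](hc (exist (fun y : 'rV[R]_n => dotv y y == 1) _ hs)) (bigD1 None) //= (bigD1 (Some i)) //= big1.
    by rewrite !mxE !eqxx /= !mulr1 addr0.
  case=> [j|]; rewrite ?eqxx //= => ji.
  by rewrite !mxE eqxx; have /negPf -> : j != i by []; rewrite !mulr0.
have hp i := h 1 i (mulr1 1); have hm i : c None + c (Some i) * -1 = 0.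
  by apply: h; rewrite mulrNN mulr1.
by case=> [i|]; [have := hp i; have := hm i|
  have := hp (Ordinal n0); have := hm (Ordinal n0)]; lra.
Qed.

(** At a fixed t the relation is bilinear in the extended coordinates of y and z, so independence on
    one sphere applies twice; the nonzero profile value is then divided out. *)
Lemma eigenfunction_free (R : realType) (n : nat) (M : moving_frame R n.-1) (t : R)
    (c : option 'I_n * option 'I_n -> R) : (0 < n)%N ->
  (forall eps eps', jacobi_profile M eps eps' t != 0) ->
  \sum_o c o *: eigenfunction M o = 0 -> forall o, c o = 0.
Proof.
move=> n0 g0 hc [i j].
have ev (y z : sphere R n) : \sum_o (\sum_o' c (o, o') * jacobi_profile M o o' t
    * sphere_coord o' z) * sphere_coord o y = 0.
  have := congr1 (fun u => u (y, z, t)) hc; rewrite fct_sumE => h.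
  rewrite -[RHS]h; under eq_bigr do rewrite mulr_suml.
  rewrite pair_bigA /=; apply: eq_bigr => -[l m] _ /=.
  by rewrite /GRing.scale /= /GRing.scale /=; ring.
have h1 z := sphere_coord_free n0 (fun y => ev y z) i.
have := sphere_coord_free n0 h1 j.
by move/eqP; rewrite mulf_eq0 (negPf (g0 _ _)) orbF => /eqP.
Qed.

(** * The Carlotto-Schulz profile *)

Section CarlottoSchulzFrame.
Variables (R : realType) (n : nat) (T r0 : R) (r theta alpha : R -> R).
Hypothesis n_gt0 : (0 < n)%N.
Hypothesis hCS : CS_profile n T r0 r theta alpha.
Implicit Types t : R.

Local Notation sr t := (sin (r t)).
Local Notation cr t := (cos (r t)).
Local Notation st t := (sin (theta t)).
Local Notation ct t := (cos (theta t)).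
Local Notation sa t := (sin (alpha t)).
Local Notation ca t := (cos (alpha t)).

(** The curve in spherical coordinates. With e_r and e_theta the unit coordinate fields on S^2, the
    velocity is cos(alpha) e_r + sin(alpha) e_theta, and the normal is - sin(alpha) e_r + cos(alpha)
    e_theta. *)
Definition cs_fa t := sr t * ct t.
Definition cs_fb t := sr t * st t.
Definition cs_fc t := cr t.
Definition cs_ga t := cr t * ct t * ca t - st t * sa t.
Definition cs_gb t := cr t * st t * ca t + ct t * sa t.
Definition cs_gc t := - (sr t * ca t).
Definition cs_na t := - (st t * ca t + cr t * ct t * sa t).
Definition cs_nb t := ct t * ca t - cr t * st t * sa t.
Definition cs_nc t := sr t * sa t.
(** Defined by the minimality relation, which therefore holds by reflexivity; the ODE for [alpha]
    then identifies it with the geodesic curvature. *)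
Definition cs_kap t := n.-1%:R * (cs_na t / cs_fa t + cs_nb t / cs_fb t).

Lemma cs_sr_gt0 t : 0 < sr t.
Proof. exact/sin_gt0_pi/(CS_r_range hCS). Qed.

Lemma cs_st_gt0 t : 0 < st t.
Proof. exact/sin_gt0_pihalf/(CS_theta_range hCS). Qed.

Lemma cs_ct_gt0 t : 0 < ct t.
Proof.
apply: cos_gt0_pihalf; have /andP[t0 ->] := CS_theta_range hCS t.
by rewrite andbT (lt_trans _ t0) // oppr_lt0 divr_gt0 // pi_gt0.
Qed.

Let sr0 t : sr t != 0. Proof. by rewrite gt_eqF // cs_sr_gt0. Qed.
Let st0 t : st t != 0. Proof. by rewrite gt_eqF // cs_st_gt0. Qed.
Let ct0 t : ct t != 0. Proof. by rewrite gt_eqF // cs_ct_gt0. Qed.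

(** Oriented for use as a reduction rule by [ring] and [field]. *)
Let cos_sqr (x : R) : cos x ^+ 2 = 1 - sin x ^+ 2.
Proof. by rewrite -(cos2Dsin2 x) addrK. Qed.

(** In polar coordinates on S^2 the geodesic curvature is alpha' + cos(r) theta'. The terms with
    cot(2 theta) come from cot(theta) - tan(theta) = 2 cot(2 theta). *)
Lemma cs_alpha_derive t :
  is_derive t 1 alpha (cs_kap t - cr t / sr t * sa t).
Proof.
apply: (is_derive_eq (CS_alpha_ode hCS t)).
have -> : n%:R = n.-1%:R + 1 :> R by rewrite -[n in LHS](prednK n_gt0) -addn1 natrD.
rewrite /cot [2 * theta t]mulr_natl sin_mulr2n cos_mulr2n.
rewrite /cs_kap /cs_na /cs_nb /cs_fa /cs_fb.
by field: (cos_sqr (theta t)); rewrite sr0 st0 ct0.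
Qed.

Lemma cs_sr_derive t : is_derive t 1 (fun t => sr t) (cr t * ca t).
Proof. exact: is_derive_comp (CS_r_ode hCS t) (is_derive_sin _). Qed.

Lemma cs_cr_derive t : is_derive t 1 (fun t => cr t) (- sr t * ca t).
Proof. exact: is_derive_comp (CS_r_ode hCS t) (is_derive_cos _). Qed.

Lemma cs_st_derive t : is_derive t 1 (fun t => st t) (ct t * (sa t / sr t)).
Proof. exact: is_derive_comp (CS_theta_ode hCS t) (is_derive_sin _). Qed.

Lemma cs_ct_derive t : is_derive t 1 (fun t => ct t) (- st t * (sa t / sr t)).
Proof. exact: is_derive_comp (CS_theta_ode hCS t) (is_derive_cos _). Qed.

Lemma cs_sa_derive t :
  is_derive t 1 (fun t => sa t) (ca t * (cs_kap t - cr t / sr t * sa t)).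
Proof. exact: is_derive_comp (cs_alpha_derive t) (is_derive_sin _). Qed.

Lemma cs_ca_derive t :
  is_derive t 1 (fun t => ca t) (- sa t * (cs_kap t - cr t / sr t * sa t)).
Proof. exact: is_derive_comp (cs_alpha_derive t) (is_derive_cos _). Qed.

Lemma cs_fa_derive t : is_derive t 1 cs_fa (cs_ga t).
Proof.
apply: (is_derive_eq (is_derive_fM (cs_sr_derive t) (cs_ct_derive t))).
by rewrite /cs_ga; field.
Qed.

Lemma cs_fb_derive t : is_derive t 1 cs_fb (cs_gb t).
Proof.
apply: (is_derive_eq (is_derive_fM (cs_sr_derive t) (cs_st_derive t))).
by rewrite /cs_gb; field.
Qed.

Lemma cs_fc_derive t : is_derive t 1 cs_fc (cs_gc t).
Proof. by apply: (is_derive_eq (cs_cr_derive t)); rewrite mulNr. Qed.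

Lemma cs_ga_derive t : is_derive t 1 cs_ga (cs_kap t * cs_na t - cs_fa t).
Proof.
apply: (is_derive_eq (is_derive_fD
  (is_derive_fM (is_derive_fM (cs_cr_derive t) (cs_ct_derive t)) (cs_ca_derive t))
  (is_derive_fN (is_derive_fM (cs_st_derive t) (cs_sa_derive t))))).
rewrite /cs_na /cs_fa.
by field: (cos_sqr (r t)) (cos_sqr (alpha t)).
Qed.

Lemma cs_gb_derive t : is_derive t 1 cs_gb (cs_kap t * cs_nb t - cs_fb t).
Proof.
apply: (is_derive_eq (is_derive_fD
  (is_derive_fM (is_derive_fM (cs_cr_derive t) (cs_st_derive t)) (cs_ca_derive t))
  (is_derive_fM (cs_ct_derive t) (cs_sa_derive t)))).
rewrite /cs_nb /cs_fb.
by field: (cos_sqr (r t)) (cos_sqr (alpha t)).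
Qed.

Lemma cs_gc_derive t : is_derive t 1 cs_gc (cs_kap t * cs_nc t - cs_fc t).
Proof.
apply: (is_derive_eq (is_derive_fN
  (is_derive_fM (cs_sr_derive t) (cs_ca_derive t)))).
rewrite /cs_nc /cs_fc.
by field: (cos_sqr (alpha t)).
Qed.

Lemma cs_na_derive t : is_derive t 1 cs_na (- (cs_kap t * cs_ga t)).
Proof.
apply: (is_derive_eq (is_derive_fN (is_derive_fD
  (is_derive_fM (cs_st_derive t) (cs_ca_derive t))
  (is_derive_fM (is_derive_fM (cs_cr_derive t) (cs_ct_derive t)) (cs_sa_derive t))))).
rewrite /cs_ga.
by field: (cos_sqr (r t)).
Qed.

Lemma cs_nb_derive t : is_derive t 1 cs_nb (- (cs_kap t * cs_gb t)).
Proof.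
apply: (is_derive_eq (is_derive_fD
  (is_derive_fM (cs_ct_derive t) (cs_ca_derive t))
  (is_derive_fN (is_derive_fM (is_derive_fM (cs_cr_derive t) (cs_st_derive t))
    (cs_sa_derive t))))).
rewrite /cs_gb.
by field: (cos_sqr (r t)).
Qed.

Lemma cs_nc_derive t : is_derive t 1 cs_nc (- (cs_kap t * cs_gc t)).
Proof.
apply: (is_derive_eq (is_derive_fM (cs_sr_derive t) (cs_sa_derive t))).
by rewrite /cs_gc; field.
Qed.

(** Closed by [Defined] so that its projections reduce to the explicit functions above. *)
Definition cs_frame : moving_frame R n.-1.
Proof.
refine (@MovingFrame R n.-1 cs_fa cs_fb cs_fc cs_ga cs_gb cs_gc cs_na cs_nb cs_nc
  cs_kap _ _ cs_fa_derive cs_fb_derive cs_fc_derive cs_ga_derive cs_gb_derive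
  cs_gc_derive cs_na_derive cs_nb_derive cs_nc_derive
  _ _ _ _ _ _ _ _ _ _ _ (fun _ => erefl _)) => t;
  rewrite /cs_fa /cs_fb /cs_fc /cs_ga /cs_gb /cs_gc /cs_na /cs_nb /cs_nc.
- by rewrite mulr_gt0 ?cs_sr_gt0 ?cs_ct_gt0.
- by rewrite mulr_gt0 ?cs_sr_gt0 ?cs_st_gt0.
all: by ring: (cos_sqr (r t)) (cos_sqr (theta t)) (cos_sqr (alpha t)).
Defined.

Lemma cs_profile_periodic eps eps' t :
  jacobi_profile cs_frame eps eps' (t + T) = jacobi_profile cs_frame eps eps' t.
Proof.
have sa2 : sa (t + T) = sa t.
  by rewrite (CS_alpha_periodic hCS) mulr_natl sinD2pi.
have ca2 : ca (t + T) = ca t.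
  by rewrite (CS_alpha_periodic hCS) mulr_natl cosD2pi.
have hr := CS_r_periodic hCS t; have htheta := CS_theta_periodic hCS t.
case: eps eps' => [] []; rewrite /= /inv_density /= ?/cs_fa ?/cs_fb ?/cs_na ?/cs_nb
  ?/cs_nc ?sa2 ?ca2 ?hr ?htheta //.
Qed.

(** At t = 0 the angle -pi/2 reduces the normal to (cos r cos theta, cos r sin theta, - sin r). Here
    cos r > 0, since r increases from r(0) to r(T/4) = pi/2. *)
Lemma cs_profile_neq0 eps eps' : jacobi_profile cs_frame eps eps' 0 != 0.
Proof.
have sa0 : sa 0 = -1 by rewrite (CS_alpha_init hCS) sinN sin_pihalf.
have ca0 : ca 0 = 0 by rewrite (CS_alpha_init hCS) cosN cos_pihalf.
have cr_gt0 : 0 < cr 0.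
  have T4 : 0 < T / 4 by rewrite divr_gt0 // (CS_T_gt0 hCS).
  apply: cos_gt0_pihalf; rewrite -[X in _ < _ < X](CS_r_quarter hCS).
  rewrite (CS_r_incr hCS) // andbT.
  have /andP[r_gt0 _] := CS_r_range hCS 0.
  by rewrite (lt_trans _ r_gt0) // oppr_lt0 divr_gt0 // pi_gt0.
have cr0 : cr 0 != 0 by rewrite gt_eqF.
case: eps eps' => [] []; rewrite /= ?/inv_density ?/cs_na ?/cs_nb ?/cs_nc ?sa0 ?ca0.
- by rewrite invr_eq0 mulf_neq0 // expf_neq0 // mulf_neq0.
- by rewrite mulr0 add0r mulrN1 opprK mulf_neq0.
- by rewrite mulr0 add0r mulrN1 opprK mulf_neq0.
- by rewrite mulrN1 oppr_eq0.
Qed.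

End CarlottoSchulzFrame.

Theorem corollary3p2 (R : realType) (n : nat) (hn : (1 < n)%N) (T r0 : R)
  (r theta alpha : R -> R) (hCS : CS_profile n T r0 r theta alpha) :
  dim_at_least (n ^ 2 + 2 * n + 1)%N
    (stability_eigenspace T (@X_CS R n r theta) (- (2 * n%:R - 1))).
Proof.
have n0 : (0 < n)%N by exact: ltnW.
pose M := cs_frame n0 hCS.
apply: (@dim_at_least_card _ _ _ (option 'I_n * option 'I_n)%type _ (eigenfunction M)).
- by rewrite card_prod card_option card_ord -!mulnn; lia.
(* In every chart [X_CS] is the [warp] of this frame by conversion. *)
- move=> o; apply: eigenfunction_in => //.
  exact: cs_profile_periodic.
- move=> c; apply: eigenfunction_free => //.
  exact: cs_profile_neq0.
Qed.
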